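(* Let $F$ be a field with $\operatorname{char} F \neq 2$. Then $F$ is not a rigid field if and only if at least one of the groups $G_1$, $G_2$ occurs as a Galois group over $F$ (i.e. there is a Galois extension $L/F$ with $\operatorname{Gal}(L/F)\cong G_1$ or $\operatorname{Gal}(L/F)\cong G_2$).
   Context: $\dot F = F\setminus\{0\}$, $\pm F^2 = F^2\cup -F^2$, and for a quadratic form $q$ over $F$, $D_F(q)$ is the set of elements of $\dot F$ represented by $q$; $\langle a_1,\dots,a_n\rangle$ denotes the form $a_1x_1^2+\dots+a_nx_n^2$. An element $a\in \dot F\setminus \pm F^2$ is rigid if $D_F(\langle 1,a\rangle)=\dot F^2\cup a\dot F^2$, and nonrigid otherwise. $F$ is rigid if every $a\in\dot F\setminus\pm F^2$ is rigid, and nonrigid otherwise. Commutators are $[\sigma,\tau]=\sigma^{-1}\tau^{-1}\sigma\tau$. $G_1$ is the group generated by $x,y$ subject to the relations $x^4=y^2=1$, $[x,y]^2=1$, $[[x,y],x]^2=1$, and $[[x,y],x]$ commutes with $x$ and with $y$ (it has order $32$). $G_2$ is the group generated by $x,y,z$ subject to the relations $x^2=y^2=z^2=1$, $[x,y]^2=[x,z]^2=[y,z]=1$, $[y,[x,z]]=[z,[x,y]]$, and this element has order dividing $2$ and commutes with $x$, $y$ and $z$ (it has order $64$). *)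

(* Defs.v *)
From HB Require Import structures.
From mathcomp Require Import all_boot all_order all_algebra all_fingroup all_solvable all_field.
Set Implicit Arguments. Unset Strict Implicit. Unset Printing Implicit Defensive.
Import GRing.Theory.
Local Open Scope ring_scope.

Definition is_square (F : fieldType) (a : F) : Prop := exists b : F, a = b ^+ 2.
Definition in_pmF2 (F : fieldType) (a : F) : Prop := is_square a \/ is_square (- a).

Definition repr_1a (F : fieldType) (a c : F) : Prop :=
  c != 0 /\ exists x y : F, c = x ^+ 2 + a * y ^+ 2.

Definition rigid_elt (F : fieldType) (a : F) : Prop :=
  forall c : F, repr_1a a c <->
    (exists b : F, b != 0 /\ (c = b ^+ 2 \/ c = a * b ^+ 2)).

Definition rigid_field (F : fieldType) : Prop :=
  forall a : F, a != 0 -> ~ in_pmF2 a -> rigid_elt a.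

Local Open Scope group_scope.

(* G occurs as the Galois group G1 (order 32) with
   [x,y] = x^-1 y^-1 x y  (MathComp's [~ x, y] has the same convention). *)
Definition isG1 (gT : finGroupType) (G : {set gT}) : Prop :=
  G \isog Grp (x : y : x ^+ 4, y ^+ 2, [~ x, y] ^+ 2, [~ [~ x, y], x] ^+ 2,
                [~ [~ x, y], x] * x = x * [~ [~ x, y], x],
                [~ [~ x, y], x] * y = y * [~ [~ x, y], x]).

(* G2 (order 64) *)
Definition isG2 (gT : finGroupType) (G : {set gT}) : Prop :=
  G \isog Grp (x : y : z : x ^+ 2, y ^+ 2, z ^+ 2, [~ x, y] ^+ 2, [~ x, z] ^+ 2,
                [~ y, z],
                [~ y, [~ x, z]] = [~ z, [~ x, y]],
                [~ y, [~ x, z]] ^+ 2,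
                [~ y, [~ x, z]] * x = x * [~ y, [~ x, z]],
                [~ y, [~ x, z]] * y = y * [~ y, [~ x, z]],
                [~ y, [~ x, z]] * z = z * [~ y, [~ x, z]]).

(* Main.v *)
Require Import Defs.
From HB Require Import structures.
From mathcomp Require Import all_boot all_order all_algebra all_fingroup all_solvable all_field.
From mathcomp Require Import ring.
From Stdlib Require Import Classical.
Set Implicit Arguments. Unset Strict Implicit. Unset Printing Implicit Defensive.
Import GRing.Theory.

(* G1 is the semidirect product of Z/4 acting on the even sign vectors in
   {+1,-1}^4, and G2 is the wreath product of Z/2 by the Klein four-group.

   Groups to forms. G1 has quotients Z/4 and D4 in which the quadratic
   character A of x is shared: the first makes A a norm from F(sqrt A), and the
   second makes some f, independent of A modulo squares, a norm from F(sqrt A).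
   G2 has two D4 quotients, and they exhibit one c as a norm from F(sqrt a) and
   from F(sqrt b), with a, b, c independent modulo squares. Both configurations
   are impossible over a rigid field.

   Forms to groups. Over a nonrigid field, after scaling, one finds either
   A = 1 + q^2 and f = m^2 - A with A, f independent modulo squares, or
   P = s^2 - c with -1, c, P independent. In the first case put k = q m - A and
   d^2 = -2 k (A - sqrt A); then F(sqrt A, d) is cyclic of degree 4 and
   theta = k + sqrt A + d has relative norm q^2 f, so adjoining the square roots
   of the conjugates of theta gives the group G1. In the second case
   theta = s + sqrt P + sqrt (-c) has norm 4 s^2 c from the biquadratic
   field, and adjoining the square roots of its conjugates gives G2. *)

(** * The finite groups G1 and G2 *)

Section FiniteGroups.
Local Open Scope group_scope.

(** Satisfying the relations does not identify a presented group: a quotient satisfies them too.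
    Here they bound the order by 16 (for G1) or 32 (for G2) times the order of one central element,
    [[[x,y],x]] or [[y,[x,z]]], and chains of subgroups show that the orders 32 and 64 are reached
    as soon as that element is nontrivial. In the Galois groups it is the automorphism negating all
    the outer square roots. The formulas for theta make products of two conjugates collapse. In the
    first case the factor [-2k] in [d^2] cancels the [sqrt A] term of [(k + sqrt A)^2 - d^2]; what
    remains is [(k + A)^2 - A q^2], which is [q^2 f] when [k + A = q m]. In the second case
    [P = s^2 + (sqrt (-c))^2], so [(s + sqrt (-c))^2 - P = 2 s sqrt (-c)]. The extension is the
    splitting field of a single octic; the inner square roots are recovered rationally from each of
    its roots. *)

Definition G1_rel (gT : finGroupType) (x y : gT) : Prop :=
  [/\ x ^+ 4 = 1, y ^+ 2 = 1, [~ x, y] ^+ 2 = 1, [~ [~ x, y], x] ^+ 2 = 1 &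
      commute [~ [~ x, y], x] x /\ commute [~ [~ x, y], x] y].

Definition G2_rel (gT : finGroupType) (x y z : gT) : Prop :=
  [/\ [/\ x ^+ 2 = 1, y ^+ 2 = 1 & z ^+ 2 = 1],
      [/\ [~ x, y] ^+ 2 = 1, [~ x, z] ^+ 2 = 1 & [~ y, z] = 1],
      [~ y, [~ x, z]] = [~ z, [~ x, y]], [~ y, [~ x, z]] ^+ 2 = 1 &
      [/\ commute [~ y, [~ x, z]] x, commute [~ y, [~ x, z]] y
        & commute [~ y, [~ x, z]] z]].

(** [\isog Grp p] is by definition a universal property: [G] has the same homomorphic images as the
    presented group. Hence the presentation only matters through the groups it maps onto. *)
Lemma isoGrp_homP (gT : finGroupType) (G : {set gT}) p
    (P : forall rT : finGroupType, {group rT} -> Prop) :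
    (forall (rT : finGroupType) (H : {group rT}), reflect (P rT H) (H \homg Grp p)) ->
  G \isog Grp p <-> forall (rT : finGroupType) (H : {group rT}), H \homg G <-> P rT H.
Proof.
move=> homP; split=> [isoG rT H | isoG rT H]; first by rewrite isoG; split=> /homP.
by apply/idP/homP => /isoG.
Qed.

(** The library evaluates a presentation as one equality of nested tuples; this is the same
    condition as a conjunction of separate equalities. *)
Fixpoint formula_holds (gT : finGroupType) (e : seq gT) (f : Presentation.formula) :=
  match f with
  | Presentation.Eq2 s t => Presentation.eval e s == Presentation.eval e t
  | Presentation.And f1 f2 => formula_holds e f1 && formula_holds e f2
  end.

Lemma and_relE (vT : finType) (v1 v2 : vT) r :
  Presentation.and_rel v1 v2 r = (v1 == v2) && r :> bool.
Proof. by case: r => /= [|wT w1 w2]; rewrite ?andbT. Qed.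

Lemma relE (gT : finGroupType) (e : seq gT) f r :
  Presentation.rel e f r = formula_holds e f && r :> bool.
Proof.
by elim: f r => [s t | f1 IH1 f2 IH2] r; rewrite /= ?and_relE // IH1 IH2 andbA.
Qed.

Lemma isG1P (gT : finGroupType) (G : {set gT}) :
  isG1 G <-> forall (rT : finGroupType) (H : {group rT}),
    H \homg G <-> exists x y : rT, <[x]> <*> <[y]> = H /\ G1_rel x y.
Proof.
apply: isoGrp_homP => rT H; apply: (iffP existsP) => [[[x y]] | [x [y [dH]]]].
  rewrite and_relE relE andbT /= => /and5P[/eqP dH /eqP r1 /eqP r2 /eqP r3].
  by case/and3P=> /eqP r4 /eqP r5 /eqP r6; exists x, y.
case=> [r1 r2 r3 r4 [r5 r6]]; exists (x, y); rewrite and_relE relE andbT /=.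
by rewrite dH eqxx /= r1 r2 r3 r4 r5 r6 !eqxx.
Qed.

Lemma isG2P (gT : finGroupType) (G : {set gT}) :
  isG2 G <-> forall (rT : finGroupType) (H : {group rT}),
    H \homg G <->
    exists x y z : rT, <[x]> <*> <[y]> <*> <[z]> = H /\ G2_rel x y z.
Proof.
apply: isoGrp_homP => rT H; apply: (iffP existsP) => [[[[x y] z]] | [x [y [z [dH]]]]].
  rewrite and_relE relE andbT /= => /and5P[/eqP dH /eqP r1 /eqP r2 /eqP r3].
  case/and5P=> /eqP r4 /eqP r5 /eqP r6 /eqP r7 /and4P[/eqP r8 /eqP r9 /eqP r10 /eqP r11].
  by exists x, y, z; split.
case=> [[r1 r2 r3] [r4 r5 r6] r7 r8 [r9 r10 r11]].
exists (x, y, z); rewrite and_relE relE andbT /=.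
by rewrite dH eqxx /= r1 r2 r3 r4 r5 r6 -r7 r8 r9 r10 r11 !eqxx.
Qed.

(** * Order bounds from chains of subgroups *)

Lemma card_proper_double (gT : finGroupType) (H K : {group gT}) (x : gT) :
  H \subset K -> x \in K -> x \notin H -> 2 * #|H| <= #|K|.
Proof.
move=> sHK Kx nHx; rewrite mulnC -(Lagrange sHK) leq_mul2l indexg_gt1.
by apply/orP; right; apply: contra nHx => /subsetP; apply.
Qed.

Lemma involution_inv (gT : finGroupType) (g : gT) : g ^+ 2 = 1 -> g^-1 = g.
Proof. by move=> g2; apply/eqP; rewrite eq_invg_mul -(expgS g 1) g2. Qed.

Lemma mem_joingl (gT : finGroupType) (A B : {set gT}) x : x \in A -> x \in A <*> B.
Proof. exact/subsetP/joing_subl. Qed.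

Lemma mem_joingr (gT : finGroupType) (A B : {set gT}) x : x \in B -> x \in A <*> B.
Proof. exact/subsetP/joing_subr. Qed.

Lemma mem_normY (gT : finGroupType) (H : {group gT}) x y :
  y ^ x \in H <*> <[y]> -> x \in 'N(H) -> x \in 'N(H <*> <[y]>).
Proof.
move=> yx nHx; apply/normP/eqP; rewrite eqEcard cardJg leqnn andbT.
by rewrite conjYg (normP nHx) join_subG joing_subl -cycleJ cycle_subG.
Qed.

Lemma mem_norm_cycle (gT : finGroupType) (x y : gT) :
  commute x y -> x \in 'N(<[y]>).
Proof. by move=> xy; rewrite (subsetP (cent_sub _)) // cent_cycle; apply/cent1P. Qed.

Lemma card_joing_cycle_le (gT : finGroupType) (H : {group gT}) x :
  x \in 'N(H) -> #|H <*> <[x]>| <= #|H| * #[x].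
Proof.
rewrite -cycle_subG => nHx; rewrite norm_joinEr // orderE mul_cardG.
by rewrite leq_pmulr // cardG_gt0.
Qed.

Lemma order_le (gT : finGroupType) (g : gT) n : g ^+ n.+1 = 1 -> #[g] <= n.+1.
Proof. by move=> gn; apply: dvdn_leq => //; rewrite order_dvdn gn. Qed.

(** The commutator is [y ^ x * y], a product of two involutions, so [y] conjugates it to its
    inverse, which is itself. *)
Lemma commute_comm_involution (gT : finGroupType) (x y : gT) :
  y ^+ 2 = 1 -> [~ x, y] ^+ 2 = 1 -> commute [~ x, y] y.
Proof.
move=> y2 c2; have cE : [~ x, y] = y ^ x * y by rewrite commgEr (involution_inv y2).
apply/commgP/conjg_fixP; rewrite conjgE {1}cE -!mulgA -(expgS y 1) y2 mulg1.
by rewrite -commgEl -invg_comm (involution_inv c2).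
Qed.

Lemma card_cent_step (gT : finGroupType) (H : {group gT}) g h :
  h \in H -> ~ commute h g -> 2 * #|(H :&: 'C[g])%G| <= #|H|.
Proof.
move=> Hh nhg; apply: (@card_proper_double _ _ _ h); rewrite ?subsetIl //.
by rewrite inE Hh /=; apply/cent1P=> hg; apply: nhg.
Qed.

Lemma mem_cent_step (gT : finGroupType) (H : {group gT}) g h :
  h \in H -> commute h g -> h \in (H :&: 'C[g])%G.
Proof. by move=> Hh hg; rewrite inE Hh; apply/cent1P. Qed.

(** * The group G1: consequences of the relations and its order *)

Section G1Relations.
Variables (gT : finGroupType) (x y c d : gT).
Hypotheses (xyP : G1_rel x y) (dc : c = [~ x, y]) (dd : d = [~ c, x]).

(** Commuting with both generators, [d] commutes with every word in them, in particular with [c].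
    The relations [c^2 = d^2 = 1] then cancel the surplus factors in the conjugates by [x ^+ 2]. *)
Lemma G1_relE :
  [/\ commute c d, commute c y & commute c (x ^+ 2)] /\
  [/\ y ^ x = y * c, c ^ x = c * d, d ^ x = d & y ^ (x ^+ 2) = y * d].
Proof.
case: xyP; rewrite -dc -dd => x4 y2 c2 d2 [dx dy].
have cE : c = y ^ x * y by rewrite dc commgEr (involution_inv y2).
have cy : commute c y by move: c2; rewrite dc => /(commute_comm_involution y2).
have yx : y ^ x = y * c.
  by rewrite -(involution_inv c2) dc invg_comm commgEl mulKVg.
have cx : c ^ x = c * d by rewrite dd commgEl mulKVg.
have dx1 : d ^ x = d by apply/conjg_fixP/commgP.
have cd : commute c d.
  rewrite cE; apply/commute_sym/commuteM => //.
  by rewrite conjgE; apply: commuteM; [apply: commuteV | apply: commuteM].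
split; split=> //.
  apply/commgP/conjg_fixP; rewrite expgS expg1 conjgM cx conjMg cx dx1 -mulgA.
  by rewrite -(expgS d 1) d2 mulg1.
rewrite expgS expg1 conjgM yx conjMg yx cx -!mulgA (mulgA c).
by rewrite -(expgS c 1) c2 mul1g.
Qed.

Lemma G1_norm : x \in 'N(<[d]> <*> <[c]> <*> <[y]>).
Proof.
have [[cd cy cx2] [yx cx dx1 yx2]] := G1_relE.
case: xyP; rewrite -dc -dd => x4 y2 c2 d2 [dx dy].
have Nc : c \in <[d]> <*> <[c]> by apply/mem_joingr/cycle_id.
apply: mem_normY.
  by rewrite yx groupM; [|apply/mem_joingr/cycle_id | apply: mem_joingl].
apply: mem_normY; last exact/mem_norm_cycle/commute_sym.
by rewrite cx groupM // mem_joingl ?cycle_id.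
Qed.

(** Starting from [<[d]>], the elements [c], [y], [x] each normalize the group built so far and
    contribute factors 2, 2, 4. Keeping [#[d]] as a factor gives 32 in general and 16 when [d] is
    trivial. *)
Lemma card_G1_le : #|<[x]> <*> <[y]>| <= #[d] * 16.
Proof.
have [[cd cy cx2] [yx cx dx1 yx2]] := G1_relE.
case: xyP; rewrite -dc -dd => x4 y2 c2 d2 [dx dy].
have nd : c \in 'N(<[d]>) by apply: mem_norm_cycle.
have ndc : y \in 'N(<[d]> <*> <[c]>).
  apply: mem_normY; last exact/mem_norm_cycle/commute_sym.
  by rewrite (conjg_fixP _) ?mem_gen ?inE ?cycle_id ?orbT //; apply/commgP.
pose N := (<[d]> <*> <[c]> <*> <[y]>)%G.
have nN : x \in 'N(N) := G1_norm.
apply: leq_trans (_ : #|N <*> <[x]>| <= _).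
  rewrite subset_leq_card // join_subG !cycle_subG.
  rewrite (mem_joingr _ (cycle_id x)) mem_joingl //.
  exact/mem_joingr/cycle_id.
apply: (leq_trans (card_joing_cycle_le nN)).
rewrite -[16]/(2 * 2 * 4)%N !mulnA; apply: leq_mul; last exact: order_le.
apply: (leq_trans (card_joing_cycle_le ndc)); apply: leq_mul; last exact: order_le.
by apply: (leq_trans (card_joing_cycle_le nd)); apply: leq_mul; last exact: order_le.
Qed.

Hypothesis d_neq1 : d != 1.

Lemma G1_ncommute : ~ commute x c /\ ~ commute (x ^+ 2) y.
Proof.
have [_ [_ _ _ yx2]] := G1_relE; split.
  by move/commute_sym/commgP; rewrite -dd (negPf d_neq1).
move/commute_sym/commgP/conjg_fixP; rewrite yx2 => /(canRL (mulKg _)).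
by rewrite mulVg => /eqP; rewrite (negPf d_neq1).
Qed.

(** Four halvings: centralizing [y] loses [x ^+ 2], centralizing [x ^+ 2] loses [y], centralizing
    [x] loses [c], and the nontrivial [d] is still there. *)
Lemma card_G1_ge16 (H : {group gT}) :
  x ^+ 2 \in H -> y \in H -> c \in H -> d \in H -> 16 <= #|H|.
Proof.
move=> Hx2 Hy Hc Hd; have [[cd cy cx2] [yx cx dx1 yx2]] := G1_relE.
case: xyP; rewrite -dc -dd => x4 y2 c2 d2 [dx dy].
have [ncx ncx2] := G1_ncommute.
have dx2 : commute d (x ^+ 2) by apply: commuteX.
pose A1 := (H :&: 'C[y])%G; pose A2 := (A1 :&: 'C[x ^+ 2])%G.
have s1 : 2 * #|A1| <= #|H| by apply: card_cent_step Hx2 _.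
have s2 : 2 * #|A2| <= #|A1|.
  by apply: (@card_cent_step _ _ _ y) => [|/commute_sym//]; apply: mem_cent_step.
have s3 : 2 * #|(A2 :&: 'C[x])%G| <= #|A2|.
  apply: (@card_cent_step _ _ _ c) => [|/commute_sym//].
  by do 2![apply: mem_cent_step => //].
have s4 : 2 <= #|(A2 :&: 'C[x])%G|.
  rewrite cardG_gt1; apply/trivgPn; exists d => //.
  by do 3![apply: mem_cent_step => //].
apply: leq_trans s1; rewrite (leq_mul2l 2 8) /=.
apply: leq_trans s2; rewrite (leq_mul2l 2 4) /=.
by apply: leq_trans s3; rewrite (leq_mul2l 2 2).
Qed.

(** One more link: the centralizer of [c] loses [x] but keeps [x ^+ 2], [y], [c] and [d]. *)
Lemma card_G1_ge (G : {group gT}) : x \in G -> y \in G -> 32 <= #|G|.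
Proof.
move=> Gx Gy; have [[cd cy cx2] _] := G1_relE; have [ncx _] := G1_ncommute.
have Gc : c \in G by rewrite dc groupR.
have Gd : d \in G by rewrite dd groupR.
apply: leq_trans (card_cent_step Gx ncx); rewrite (leq_mul2l 2 16) /=.
apply: card_G1_ge16; apply: mem_cent_step => //; try exact: commute_sym.
by rewrite groupX.
Qed.

(** The subgroup centralizes [y] and [x ^+ 2] does not. It is the kernel of the Z/4 quotient, so its
    fixed field is the cyclic quartic field. *)
Lemma G1_x2_notin : x ^+ 2 \notin <[d]> <*> <[c]> <*> <[y]>.
Proof.
have [[cd cy cx2] _] := G1_relE; have [_ ncx2] := G1_ncommute.
case: xyP; rewrite -dc -dd => x4 y2 c2 d2 [dx dy].
apply/negP=> yx2; apply: ncx2; apply/cent1P; apply: subsetP yx2.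
by rewrite !join_subG !cycle_subG; apply/andP; split; [apply/andP; split|]; apply/cent1P.
Qed.

(** The subgroup has order at most 8; with [c] inside, it would have order at least 16. *)
Lemma G1_c_notin : c \notin <[d]> <*> <[y]> <*> <[x ^+ 2]>.
Proof.
have [_ [yx cx dx1 yx2]] := G1_relE.
case: xyP; rewrite -dc -dd => x4 y2 c2 d2 [dx dy].
apply/negP=> yc; have dx2 : commute (x ^+ 2) d by apply/commute_sym/commuteX.
have nd : y \in 'N(<[d]>) by apply/mem_norm_cycle/commute_sym.
have ndx : x ^+ 2 \in 'N(<[d]> <*> <[y]>).
  apply: mem_normY; last exact/mem_norm_cycle.
  by rewrite yx2 groupM ?(mem_joingr _ (cycle_id _)) ?(mem_joingl _ (cycle_id d)).
have: 16 <= #|<[d]> <*> <[y]> <*> <[x ^+ 2]>|.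
  apply: (@card_G1_ge16 (_ <*> _)%G) => //; first exact/mem_joingr/cycle_id.
    exact/mem_joingl/mem_joingr/cycle_id.
  exact/mem_joingl/mem_joingl/cycle_id.
apply/negP; rewrite -ltnNge; apply: (@leq_ltn_trans (2 * 2 * 2)%N) => //.
apply: (leq_trans (card_joing_cycle_le ndx)); apply: leq_mul.
  by apply: (leq_trans (card_joing_cycle_le nd)); apply: leq_mul; apply: order_le.
by apply: order_le; rewrite -expgM.
Qed.
End G1Relations.

(** A subdirect product [K] no larger than [G] is the graph of a homomorphism: its projection to [G]
    is an isomorphism, and the other projection makes [H] an image. *)
Lemma homg_pair (gT rT : finGroupType) (K : {group gT * rT}) (G : {group gT})
    (H : {group rT}) :
  fst @* K = G -> snd @* K = H -> #|K| <= #|G| -> H \homg G.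
Proof.
move=> KG KH leKG; have isoK : G \isog K.
  by rewrite isogEcard leKG andbT -KG morphim_homg ?subsetT.
by rewrite (eq_homgr _ isoK) -KH morphim_homg ?subsetT.
Qed.

Lemma G1_rel_morphim (gT rT : finGroupType) (D : {group gT})
    (f : {morphism D >-> rT}) x y :
  x \in D -> y \in D -> G1_rel x y -> G1_rel (f x) (f y).
Proof.
move=> Dx Dy [x4 y2 c2 d2 [dx dy]]; have Dc : [~ x, y] \in D by rewrite groupR.
have Dd : [~ [~ x, y], x] \in D by rewrite groupR.
rewrite /G1_rel /commute -!(morphR f Dx Dy) -!(morphR f Dc Dx).
by rewrite -!morphX // x4 y2 c2 d2 !morph1 -!morphM // dx dy.
Qed.

(** Given generators of [H] satisfying the relations, the pairs with [x] and [y] satisfy them too,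
    so they generate at most 32 elements, no more than [G] has. *)
Lemma isG1_intro (gT : finGroupType) (G : {group gT}) x y :
  <[x]> <*> <[y]> = G -> G1_rel x y -> [~ [~ x, y], x] != 1 -> isG1 G.
Proof.
move=> defG xyP nd; have [Gx Gy] : x \in G /\ y \in G.
  by rewrite -defG; split; [apply/mem_joingl/cycle_id | apply/mem_joingr/cycle_id].
apply/isG1P=> rT H; split=> [/homgP[f <-] | [x' [y' [defH xyP']]]].
  exists (f x), (f y); split; last exact: G1_rel_morphim.
  by rewrite -!morphim_cycle // -morphimY ?cycle_subG // defG.
pose X := (x, x'); pose Y := (y, y'); pose K := (<[X]> <*> <[Y]>)%G.
have XYP : G1_rel X Y.
  case: xyP xyP' => [a1 a2 a3 a4 [a5 a6]] [b1 b2 b3 b4 [b5 b6]].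
  split; [exact: (congr2 pair a1 b1) | exact: (congr2 pair a2 b2)
    | exact: (congr2 pair a3 b3) | exact: (congr2 pair a4 b4) |].
  by split; [exact: (congr2 pair a5 b5) | exact: (congr2 pair a6 b6)].
apply: (@homg_pair _ _ K).
- by rewrite morphimY ?subsetT // !morphim_cycle ?inE.
- by rewrite morphimY ?subsetT // !morphim_cycle ?inE.
apply: (@leq_trans 32); last exact: (card_G1_ge xyP erefl erefl nd).
apply: leq_trans (card_G1_le XYP erefl erefl) _.
by rewrite (leq_mul2r 16 _ 2) order_le //; case: XYP.
Qed.

(* The permutations of (Z/4) * {+1, -1} given by i |-> i + 1 and by the sign
   changes at two adjacent places; the first two bits encode i. *)
Lemma G1_model : exists x y : {perm bool * bool * bool},
  G1_rel x y /\ [~ [~ x, y], x] != 1.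
Proof.
pose fx (p : bool * bool * bool) := let: (b, a, s) := p in (b (+) a, ~~ a, s).
pose gx (p : bool * bool * bool) := let: (b, a, s) := p in (b (+) ~~ a, ~~ a, s).
pose fy (p : bool * bool * bool) := let: (b, a, s) := p in (b, a, s (+) b).
have fxK : cancel fx gx by move=> [[[] []] []].
have gxK : cancel gx fx by move=> [[[] []] []].
have fyK : cancel fy fy by move=> [[[] []] []].
pose x := perm (can_inj fxK); pose x' := perm (can_inj gxK); pose y := perm (can_inj fyK).
have xV : x^-1 = x'.
  by apply/eqP; rewrite eq_invg_mul; apply/eqP/permP=> p; rewrite permM !permE /= fxK.
have yV : y^-1 = y.
  by apply/eqP; rewrite eq_invg_mul; apply/eqP/permP=> p; rewrite permM !permE /= fyK.
exists x, y.
(* Naming the commutators through existentials keeps them opaque, so only their pointwise formulas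
   enter the computations. *)
have [c dc] : exists c, c = [~ x, y] by exists [~ x, y].
have [d dd] : exists d, d = [~ c, x] by exists [~ c, x].
have cE p : c p = (p.1, p.2 (+) ~~ p.1.2).
  rewrite dc commgEl conjgE xV yV !permM !permE /=; by case: p => [[[] []] []].
have cV : c^-1 = c.
  by apply/eqP; rewrite eq_invg_mul; apply/eqP/permP=> p; rewrite permM perm1 !cE; case: p => [[[] []] []].
have dE p : d p = (p.1, ~~ p.2).
  by rewrite dd commgEl conjgE xV cV !permM !cE !permE /=; case: p => [[[] []] []].
rewrite /G1_rel -dc -dd; split; last first.
  apply/eqP=> /permP/(_ (false, false, false)); by rewrite dE perm1.
have sq (g : {perm bool * bool * bool}) : (forall p, g (g p) = p) -> g ^+ 2 = 1.
  by move=> gg; apply/permP=> p; rewrite expgS permM perm1 gg.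
split.
- by apply/permP=> p; rewrite !expgS expg0 !permM !permE /=; case: p => [[[] []] []].
- by apply: sq => p; rewrite !permE /= fyK.
- by apply: sq => p; rewrite !cE; case: p => [[[] []] []].
- by apply: sq => p; rewrite !dE; case: p => [[[] []] []].
- by split; apply/permP=> p; rewrite !permM !dE !permE /=; case: p => [[[] []] []].
Qed.

(** The model group is an image of [G] of order at least 32, while a trivial [[~ [~ x, y], x]] would
    bound the order of [G] by 16. *)
Lemma isG1_elim (gT : finGroupType) (G : {group gT}) : isG1 G ->
  exists x y, [/\ <[x]> <*> <[y]> = G, G1_rel x y & [~ [~ x, y], x] != 1].
Proof.
move/isG1P=> isoG; have /isoG[x [y [defG xyP]]] := homg_refl G.
exists x, y; split=> //; apply/eqP=> d1.
have [x' [y' [xyP' nd']]] := G1_model.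
have /leq_homg := proj2 (isoG _ (<[x']> <*> <[y']>)%G) (ex_intro _ x' (ex_intro _ y' (conj erefl xyP'))).
apply/negP; rewrite -ltnNge; apply: leq_trans (card_G1_ge xyP' erefl erefl nd' _ _).
- by have := card_G1_le xyP erefl erefl; rewrite d1 order1 defG ltnS => /leq_trans->.
- exact/mem_joingl/cycle_id.
exact/mem_joingr/cycle_id.
Qed.

(** * The group G2: consequences of the relations and its order *)

Section G2Relations.
Variables (gT : finGroupType) (x y z u v w : gT).
Hypotheses (xyzP : G2_rel x y z) (du : u = [~ x, y]) (dv : v = [~ x, z]).
Hypothesis dw : w = [~ y, v].

Lemma G2_relE :
  [/\ x ^+ 2 = 1, y ^+ 2 = 1, z ^+ 2 = 1 & w ^+ 2 = 1] /\
  [/\ u ^+ 2 = 1, v ^+ 2 = 1 & w = [~ z, u]] /\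
  [/\ commute x u, commute x v, commute y u, commute z v & commute y z] /\
  [/\ commute x w, commute y w, commute z w, commute u w & commute v w] /\
  [/\ commute u v, x ^ y = x * u, x ^ z = x * v, u ^ z = u * w & v ^ y = v * w].
Proof.
case: xyzP; rewrite -du -dv -dw => [[x2 y2 z2] [u2 v2 yz] zu w2 [wx wy wz]].
have xu : commute x u.
  apply/commute_sym; rewrite -(involution_inv u2) du invg_comm.
  by apply: commute_comm_involution; rewrite // -invg_comm -du (involution_inv u2).
have xv : commute x v.
  apply/commute_sym; rewrite -(involution_inv v2) dv invg_comm.
  by apply: commute_comm_involution; rewrite // -invg_comm -dv (involution_inv v2).
have yu : commute y u by apply/commute_sym; move: u2; rewrite du => /(commute_comm_involution y2).
have zv : commute z v by apply/commute_sym; move: v2; rewrite dv => /(commute_comm_involution z2).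
have wu : commute w u by rewrite du commgEl conjgE; do 3?[apply: commuteM => //]; apply: commuteV.
have wv : commute w v by rewrite dv commgEl conjgE; do 3?[apply: commuteM => //]; apply: commuteV.
have xy : x ^ y = x * u by rewrite du commgEl mulKVg.
have xz : x ^ z = x * v by rewrite dv commgEl mulKVg.
have vy : v ^ y = v * w.
  by rewrite -(involution_inv w2) dw invg_comm commgEl mulKVg.
have uz : u ^ z = u * w.
  by rewrite -(involution_inv w2) zu invg_comm commgEl mulKVg.
(* Conjugating [x v = v x] by [y] gives [x u v w = v w x u]; the central [w] cancels, and [x]
   commutes with [v]. *)
have uv : commute u v.
  have /(congr1 (conjg^~ y)) : x * v = v * x by [].
  rewrite !conjMg xy vy -[v * w * _]mulgA [w * _](commuteM wx wu) !mulgA.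
  by move/mulIg; rewrite -xv -!mulgA => /mulgI.
by do !split=> //; try exact/commgP/eqP; apply: commute_sym.
Qed.

Lemma card_G2_le : #|<[x]> <*> <[y]> <*> <[z]>| <= #[w] * 32.
Proof.
have [[x2 y2 z2 w2] [[u2 v2 zu] [[xu xv yu zv yz] [[xw yw zw uw vw]]]]] := G2_relE.
move=> [uv xy xz uz vy].
pose Nu := (<[w]> <*> <[u]>)%G; pose Nv := (Nu <*> <[v]>)%G.
pose Nx := (Nv <*> <[x]>)%G; pose Ny := (Nx <*> <[y]>)%G.
have Jl (H : {group gT}) a g : g \in H -> g \in (H <*> <[a]>)%G by apply: mem_joingl.
have Jr (H : {group gT}) a : a \in (H <*> <[a]>)%G by apply/mem_joingr/cycle_id.
have uNu : u \in Nu by apply: Jr.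
have wNu : w \in Nu by apply/Jl/cycle_id.
have fixJ (a b : gT) : commute a b -> b ^ a = b by move=> ab; apply/conjg_fixP/commgP/commute_sym.
have nw : u \in 'N(<[w]>) by apply: mem_norm_cycle.
have nNu g : commute g u -> commute g w -> g \in 'N(Nu).
  by move=> gu gw; apply: mem_normY; rewrite ?fixJ ?mem_norm_cycle.
have nNv g : commute g u -> commute g v -> commute g w -> g \in 'N(Nv).
  by move=> gu gv gw; apply: mem_normY; rewrite ?fixJ ?Jr ?nNu.
have nNx : y \in 'N(Nx).
  apply: mem_normY; first by rewrite xy groupM ?Jr //; apply/Jl/Jl.
  apply: mem_normY; last exact: nNu.
  by rewrite vy groupM ?Jr //; apply: Jl.
have nNy : z \in 'N(Ny).
  apply: mem_normY; first by rewrite fixJ ?Jr //; apply: commute_sym.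
  apply: mem_normY; first by rewrite xz groupM ?Jr //; apply/Jl/Jr.
  apply: mem_normY; first by rewrite fixJ ?Jr.
  apply: mem_normY; last exact: mem_norm_cycle.
  by rewrite uz groupM.
apply: (@leq_trans #|Ny <*> <[z]>|).
  rewrite subset_leq_card // genS // setSU // join_subG !cycle_subG.
  by apply/andP; split; [apply/Jl/Jr | apply: Jr].
rewrite -[32]/(2 * 2 * 2 * 2 * 2)%N !mulnA.
apply: (leq_trans (card_joing_cycle_le nNy)); apply: leq_mul; last exact: order_le.
apply: (leq_trans (card_joing_cycle_le nNx)); apply: leq_mul; last exact: order_le.
apply: (leq_trans (card_joing_cycle_le (nNv x _ _ _))) => //.
apply: leq_mul; last exact: order_le.
apply: (leq_trans (card_joing_cycle_le (nNu v _ _))) => //.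
apply: leq_mul; last exact: order_le.
by apply: (leq_trans (card_joing_cycle_le nw)); apply: leq_mul; last exact: order_le.
Qed.

Hypothesis w_neq1 : w != 1.

(** The chain loses [z] to the centralizer of [u], [x] to the normalizer of [<w, y>], [v] to the
    centralizer of [y] and [u] to that of [z], with [w] remaining. The normalizer separates [x] from
    [v], neither of which commutes with [y]: [y ^ v = y * w] stays in [<w, y>], but [y ^ x = y * u]
    leaves it, since [z] centralizes [<w, y>] and not [u]. *)
Lemma card_G2_ge32 (H : {group gT}) :
  x \in H -> z \in H -> u \in H -> v \in H -> w \in H -> 32 <= #|H|.
Proof.
have [[x2 y2 z2 w2] [[u2 v2 zu] [[xu xv yu zv yz] [[xw yw zw uw vw]]]]] := G2_relE.
move=> [uv xy xz uz vy] Hx Hz Hu Hv Hw.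
have nzu : ~ commute z u by move/commgP; rewrite -zu (negPf w_neq1).
have nyv : ~ commute y v by move/commgP; rewrite -dw (negPf w_neq1).
have fixJ (a b : gT) : commute a b -> b ^ a = b by move=> ab; apply/conjg_fixP/commgP/commute_sym.
pose M := (<[w]> <*> <[y]>)%G.
have yM : y \in M by apply/mem_joingr/cycle_id.
have wM : w \in M by apply/mem_joingl/cycle_id.
have nM g : commute g w -> y ^ g \in M -> g \in 'N(M).
  by move=> gw ygM; apply: mem_normY; rewrite // mem_norm_cycle.
have xnM : x \notin 'N(M).
  apply/negP=> /normP xM; have : y ^ x \in M by rewrite -xM memJ_conjg.
  have -> : y ^ x = y * u.
    by rewrite -(involution_inv u2) du invg_comm commgEl mulKVg.
  rewrite groupMl // => /(subsetP _ _)-/(_ 'C[z]) uz'; apply: nzu.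
  apply/commute_sym/cent1P/uz'.
  by rewrite join_subG !cycle_subG; apply/andP; split; apply/cent1P; rewrite ?/commute //; apply: commute_sym.
pose A1 := (H :&: 'C[u])%G; pose A2 := (A1 :&: 'N(M))%G; pose A3 := (A2 :&: 'C[y])%G.
have s1 : 2 * #|A1| <= #|H| by apply: card_cent_step Hz _.
have s2 : 2 * #|A2| <= #|A1|.
  apply: (@card_proper_double _ _ _ x); rewrite ?subsetIl ?mem_cent_step //.
  by rewrite inE negb_and xnM orbT.
have vA2 : v \in A2.
  rewrite inE mem_cent_step //= ?nM //; try exact: commute_sym.
  have -> : y ^ v = y * w by rewrite dw commgEl mulKVg.
  by rewrite groupM.
have s3 : 2 * #|A3| <= #|A2| by apply: card_cent_step vA2 _ => /commute_sym.
have uA3 : u \in A3.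
  apply: mem_cent_step; last exact: commute_sym.
  by rewrite inE mem_cent_step //= nM // fixJ //; apply: commute_sym.
have s4 : 2 * #|(A3 :&: 'C[z])%G| <= #|A3| by apply: card_cent_step uA3 _ => /commute_sym.
have s5 : 2 <= #|(A3 :&: 'C[z])%G|.
  rewrite cardG_gt1; apply/trivgPn; exists w => //.
  apply: mem_cent_step; last exact: commute_sym.
  apply: mem_cent_step; last exact: commute_sym.
  rewrite inE mem_cent_step //=; try exact: commute_sym.
  by rewrite nM // fixJ //; apply: commute_sym.
apply: leq_trans s1; rewrite (leq_mul2l 2 16) /=.
apply: leq_trans s2; rewrite (leq_mul2l 2 8) /=.
apply: leq_trans s3; rewrite (leq_mul2l 2 4) /=.
by apply: leq_trans s4; rewrite (leq_mul2l 2 2).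
Qed.

Lemma card_G2_ge (G : {group gT}) : x \in G -> y \in G -> z \in G -> 64 <= #|G|.
Proof.
have [[x2 y2 z2 w2] [[u2 v2 zu] [[xu xv yu zv yz] [[xw yw zw uw vw]]]]] := G2_relE.
move=> [uv xy xz uz vy] Gx Gy Gz.
have nyv : ~ commute y v by move/commgP; rewrite -dw (negPf w_neq1).
have Gu : u \in G by rewrite du groupR.
have Gv : v \in G by rewrite dv groupR.
have Gw : w \in G by rewrite dw groupR.
apply: leq_trans (card_cent_step Gy nyv); rewrite (leq_mul2l 2 32) /=.
by apply: card_G2_ge32; apply: mem_cent_step => //; apply: commute_sym.
Qed.

(** The subgroup has order at most 16, and [u] would raise it to 32. Its fixed field supplies the
    square root [rho] that [u] negates. *)
Lemma G2_u_notin : u \notin <[w]> <*> <[v]> <*> <[x]> <*> <[z]>.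
Proof.
have [[x2 y2 z2 w2] [[u2 v2 zu] [[xu xv yu zv yz] [[xw yw zw uw vw]]]]] := G2_relE.
move=> [uv xy xz uz vy].
pose Nv := (<[w]> <*> <[v]>)%G; pose Nx := (Nv <*> <[x]>)%G.
have Jl (H : {group gT}) a g : g \in H -> g \in (H <*> <[a]>)%G by apply: mem_joingl.
have Jr (H : {group gT}) a : a \in (H <*> <[a]>)%G by apply/mem_joingr/cycle_id.
have fixJ (a b : gT) : commute a b -> b ^ a = b by move=> ab; apply/conjg_fixP/commgP/commute_sym.
have nw : v \in 'N(<[w]>) by apply: mem_norm_cycle.
have nNv g : commute g v -> commute g w -> g \in 'N(Nv).
  by move=> gv gw; apply: mem_normY; rewrite ?fixJ ?Jr ?mem_norm_cycle.
have nNx : z \in 'N(Nx).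
  by apply: mem_normY; [rewrite xz groupM ?Jr //; apply/Jl/Jr | apply: nNv].
apply/negP=> Hu; suff : 32 <= 2 * 2 * 2 * 2 by [].
have: 32 <= #|Nx <*> <[z]>|.
  apply: (@card_G2_ge32 (_ <*> _)%G); [exact/Jl/Jr | exact/mem_joingr/cycle_id | by []
    | exact/Jl/Jl/Jr | exact/Jl/Jl/Jl/cycle_id].
move/leq_trans; apply.
apply: (leq_trans (card_joing_cycle_le nNx)); apply: leq_mul; last exact: order_le.
apply: (leq_trans (card_joing_cycle_le (nNv x _ _))) => //.
apply: leq_mul; last exact: order_le.
by apply: (leq_trans (card_joing_cycle_le nw)); apply: leq_mul; exact: order_le.
Qed.
End G2Relations.

(** This symmetry, due to the relation equating the two triple commutators, yields the second
    dihedral quotient from the first. *)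
Lemma G2_rel_sym (gT : finGroupType) (x y z : gT) : G2_rel x y z -> G2_rel x z y.
Proof.
case=> [[x2 y2 z2] [u2 v2 yz] e w2 [wx wy wz]].
by split; rewrite -?e //; split=> //; rewrite -invg_comm yz invg1.
Qed.

Lemma G2_rel_morphim (gT rT : finGroupType) (D : {group gT})
    (f : {morphism D >-> rT}) x y z :
  x \in D -> y \in D -> z \in D -> G2_rel x y z -> G2_rel (f x) (f y) (f z).
Proof.
move=> Dx Dy Dz [[x2 y2 z2] [u2 v2 yz] e w2 [wx wy wz]].
have Du : [~ x, y] \in D by rewrite groupR.
have Dv : [~ x, z] \in D by rewrite groupR.
have Dw : [~ y, [~ x, z]] \in D by rewrite groupR.
rewrite /G2_rel /commute -!(morphR f Dx Dy) -!(morphR f Dx Dz) -!(morphR f Dy Dv).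
rewrite -!(morphR f Dz Du) -!(morphR f Dy Dz) -!morphX // x2 y2 z2 u2 v2 yz w2.
by rewrite !morph1 -e -!morphM // wx wy wz.
Qed.

Lemma isG2_intro (gT : finGroupType) (G : {group gT}) x y z :
  <[x]> <*> <[y]> <*> <[z]> = G -> G2_rel x y z -> [~ y, [~ x, z]] != 1 -> isG2 G.
Proof.
move=> defG xyzP nw; have [Gx Gy Gz] : [/\ x \in G, y \in G & z \in G].
  rewrite -defG; split; first exact/mem_joingl/mem_joingl/cycle_id.
    exact/mem_joingl/mem_joingr/cycle_id.
  exact/mem_joingr/cycle_id.
apply/isG2P=> rT H; split=> [/homgP[f <-] | [x' [y' [z' [defH xyzP']]]]].
  exists (f x), (f y), (f z); split; last exact: G2_rel_morphim.
  by rewrite -!morphim_cycle // -!morphimY ?join_subG ?cycle_subG ?Gx // defG.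
pose X := (x, x'); pose Y := (y, y'); pose Z := (z, z').
pose K := (<[X]> <*> <[Y]> <*> <[Z]>)%G.
have XYZP : G2_rel X Y Z.
  case: xyzP xyzP' => [[a1 a2 a3] [a4 a5 a6] a7 a8 [a9 a10 a11]].
  case=> [[b1 b2 b3] [b4 b5 b6] b7 b8 [b9 b10 b11]].
  split; [split | split | | | split].
  - exact: (congr2 pair a1 b1).
  - exact: (congr2 pair a2 b2).
  - exact: (congr2 pair a3 b3).
  - exact: (congr2 pair a4 b4).
  - exact: (congr2 pair a5 b5).
  - exact: (congr2 pair a6 b6).
  - exact: (congr2 pair a7 b7).
  - exact: (congr2 pair a8 b8).
  - exact: (congr2 pair a9 b9).
  - exact: (congr2 pair a10 b10).
  - exact: (congr2 pair a11 b11).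
apply: (@homg_pair _ _ K).
- by rewrite !morphimY ?subsetT // !morphim_cycle ?inE.
- by rewrite !morphimY ?subsetT // !morphim_cycle ?inE.
apply: (@leq_trans 64); last exact: (card_G2_ge xyzP erefl erefl erefl nw).
apply: leq_trans (card_G2_le XYZP erefl erefl erefl) _.
by rewrite (leq_mul2r 32 _ 2) order_le //; case: XYZP.
Qed.

(* The permutations of (Z/2)^2 * {+1, -1} given by the two translations and by
   the sign change at one place. *)
Lemma G2_model : exists x y z : {perm bool * bool * bool},
  G2_rel x y z /\ [~ y, [~ x, z]] != 1.
Proof.
pose fx (p : bool * bool * bool) := let: (b, a, s) := p in (b, a, s (+) (a && b)).
pose fy (p : bool * bool * bool) := let: (b, a, s) := p in (b, ~~ a, s).
pose fz (p : bool * bool * bool) := let: (b, a, s) := p in (~~ b, a, s).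
have fxK : cancel fx fx by move=> [[[] []] []].
have fyK : cancel fy fy by move=> [[[] []] []].
have fzK : cancel fz fz by move=> [[[] []] []].
pose x := perm (can_inj fxK); pose y := perm (can_inj fyK); pose z := perm (can_inj fzK).
have sq (g : {perm bool * bool * bool}) : (forall p, g (g p) = p) -> g ^+ 2 = 1.
  by move=> gg; apply/permP=> p; rewrite expgS permM perm1 gg.
have x2 : x ^+ 2 = 1 by apply: sq => p; rewrite !permE /= fxK.
have y2 : y ^+ 2 = 1 by apply: sq => p; rewrite !permE /= fyK.
have z2 : z ^+ 2 = 1 by apply: sq => p; rewrite !permE /= fzK.
have [u du] : exists u, u = [~ x, y] by exists [~ x, y].
have [v dv] : exists v, v = [~ x, z] by exists [~ x, z].
have [w dw] : exists w, w = [~ y, v] by exists [~ y, v].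
have uE p : u p = (p.1, p.2 (+) p.1.1).
  rewrite du commgEl conjgE !involution_inv // !permM !permE /=.
  by case: p => [[[] []] []].
have vE p : v p = (p.1, p.2 (+) p.1.2).
  rewrite dv commgEl conjgE !involution_inv // !permM !permE /=.
  by case: p => [[[] []] []].
have u2 : u ^+ 2 = 1 by apply: sq => p; rewrite !uE; case: p => [[[] []] []].
have v2 : v ^+ 2 = 1 by apply: sq => p; rewrite !vE; case: p => [[[] []] []].
have wE p : w p = (p.1, ~~ p.2).
  rewrite dw commgEl conjgE !involution_inv // !permM !vE !permE /=.
  by case: p => [[[] []] []].
have w2 : w ^+ 2 = 1 by apply: sq => p; rewrite !wE; case: p => [[[] []] []].
have wu : w = [~ z, u].
  apply/permP=> p; rewrite wE commgEl conjgE !involution_inv // !permM !uE !permE /=.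
  by case: p => [[[] []] []].
exists x, y, z; rewrite /G2_rel -du -dv -dw -wu; split; last first.
  by apply/eqP=> /permP/(_ (false, false, false)); rewrite wE perm1.
split=> //; split=> //; try by apply/permP=> p; rewrite !permM !wE !permE /=; case: p => [[[] []] []].
apply/eqP/commgP; by apply/permP=> p; rewrite !permM !permE /=; case: p => [[[] []] []].
Qed.

Lemma isG2_elim (gT : finGroupType) (G : {group gT}) : isG2 G ->
  exists x y z, [/\ <[x]> <*> <[y]> <*> <[z]> = G, G2_rel x y z & [~ y, [~ x, z]] != 1].
Proof.
move/isG2P=> isoG; have /isoG[x [y [z [defG xyzP]]]] := homg_refl G.
exists x, y, z; split=> //; apply/eqP=> w1.
have [x' [y' [z' [xyzP' nw']]]] := G2_model.
have /leq_homg : (<[x']> <*> <[y']> <*> <[z']>)%G \homg G.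
  by apply/isoG; exists x', y', z'.
apply/negP; rewrite -ltnNge; apply: leq_trans (card_G2_ge xyzP' erefl erefl erefl nw' _ _ _).
- by have := card_G2_le xyzP erefl erefl erefl; rewrite w1 order1 defG ltnS => /leq_trans->.
- exact/mem_joingl/mem_joingl/cycle_id.
- exact/mem_joingl/mem_joingr/cycle_id.
exact/mem_joingr/cycle_id.
Qed.

End FiniteGroups.

(** * Binary forms over rigid and nonrigid fields *)

Section BinaryForms.
Local Open Scope ring_scope.

Section Squares.
Variable F : fieldType.
Implicit Types a b c f A m n p q : F.

Lemma is_square0 : is_square (0 : F). Proof. by exists 0; rewrite expr0n. Qed.

Lemma nonsquare_neq0 a : ~ is_square a -> a != 0.
Proof. by move=> nsq; apply/eqP=> a0; apply: nsq; rewrite a0; apply: is_square0. Qed.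

Lemma is_square_mulr a b : b != 0 -> is_square (a * b ^+ 2) -> is_square a.
Proof. by move=> nzb [c E]; exists (c / b); rewrite expr_div_n -E mulfK ?expf_neq0. Qed.

Lemma is_squareM a b : is_square a -> is_square b -> is_square (a * b).
Proof. by move=> [u ->] [v ->]; exists (u * v); rewrite exprMn. Qed.

Lemma rigid_reprE a c x y : rigid_field F -> ~ is_square a -> ~ is_square (- a) ->
  c != 0 -> c = x ^+ 2 + a * y ^+ 2 -> is_square c \/ exists b, c = a * b ^+ 2.
Proof.
move=> rigF nsa nsNa nzc cE.
have [] := rigF a (nonsquare_neq0 nsa) _ c; first by case.
case=> [|b [_ [E | E]] _]; first by split=> //; exists x, y.
  by left; exists b.
by right; exists b.
Qed.

(** Since [f] is a nonsquare value of [<1, -A>], rigidity of [-A] puts it in the class of [-A]. This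
    presupposes that [-A] is not a square; otherwise [-f] is a nonsquare, and [A n^2 = m^2 - f]
    violates rigidity of [-f]. *)
Lemma rigid_norm A f m n :
    rigid_field F -> ~ is_square A -> ~ is_square f -> ~ is_square (A * f) ->
  f = m ^+ 2 - A * n ^+ 2 -> ~ is_square (- A) /\ is_square (- (A * f)).
Proof.
move=> rigF nsA nsf nsAf fE; have nzf := nonsquare_neq0 nsf.
have nzA := nonsquare_neq0 nsA.
have nzn : n != 0.
  by apply/eqP=> n0; apply: nsf; exists m; rewrite fE n0 expr0n mulr0 subr0.
have nsNA : ~ is_square (- A).
  move=> [e Ae]; have AE : A = - e ^+ 2 by rewrite -Ae opprK.
  have nsNf : ~ is_square (- f).
    by move=> [g E]; apply: nsAf; exists (e * g); rewrite exprMn -Ae -E mulrNN.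
  have [||| [b E] | [b E]] := @rigid_reprE (- f) (A * n ^+ 2) m 1 rigF nsNf.
  - by rewrite opprK.
  - by rewrite mulf_neq0 ?expf_neq0.
  - by rewrite fE; ring.
  - by apply: nsA; apply: (is_square_mulr nzn); exists b.
  - have nzb : b != 0.
      apply: contraNneq (mulf_neq0 nzA (expf_neq0 2 nzn)) => b0.
      by rewrite E b0 expr0n mulr0.
    apply: nsf; apply: (is_square_mulr nzb); exists (e * n).
    by rewrite exprMn -Ae mulNr E mulNr opprK.
split=> //; have [|||//|[b E]] := @rigid_reprE (- A) f m n rigF nsNA.
- by rewrite opprK.
- by [].
- by rewrite mulNr.
- by exists (A * b); rewrite E; ring.
Qed.

(** If [F] were rigid, [A], being a nonsquare value of [<1, -A>], would lie in the class of [-A],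
    making [-1] a square; but [-(A f)] is a square by [rigid_norm], so [A f] would be one. *)
Lemma nonrigid_G1 A f m n p q :
    ~ is_square A -> ~ is_square f -> ~ is_square (A * f) ->
  f = m ^+ 2 - A * n ^+ 2 -> A = p ^+ 2 - A * q ^+ 2 -> ~ rigid_field F.
Proof.
move=> nsA nsf nsAf fE AE rigF.
have [nsNA sqAf] := rigid_norm rigF nsA nsf nsAf fE.
have nzA := nonsquare_neq0 nsA.
have [|||//|[b E]] := @rigid_reprE (- A) A p q rigF nsNA.
- by rewrite opprK.
- by [].
- by rewrite mulNr.
- apply: nsAf; rewrite -[A * f]opprK -mulN1r; apply: is_squareM => //.
  by exists b; apply: (mulfI nzA); rewrite mulrN1 {1}E; ring.
Qed.

Lemma nonrigid_G2 a b c m n p q :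
    ~ is_square a -> ~ is_square b -> ~ is_square c ->
    ~ is_square (a * b) -> ~ is_square (a * c) -> ~ is_square (b * c) ->
  c = m ^+ 2 - a * n ^+ 2 -> c = p ^+ 2 - b * q ^+ 2 -> ~ rigid_field F.
Proof.
move=> nsa nsb nsc nsab nsac nsbc ac bc rigF.
have [_ sqac] := rigid_norm rigF nsa nsc nsac ac.
have [_ sqbc] := rigid_norm rigF nsb nsc nsbc bc.
apply: nsab; apply: (is_square_mulr (nonsquare_neq0 nsc)).
by have := is_squareM sqac sqbc; congr is_square; ring.
Qed.

(** Scaling has made one square in [A] and the coefficient of [A] in the norm equal to 1. The three
    nonsquares express independence of [A] and [f] modulo squares. *)
Definition G1_datum q m (A := 1 + q ^+ 2) (f := m ^+ 2 - A) :=
  [/\ ~ is_square A, ~ is_square f & ~ is_square (A * f)].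

(** The seven nonsquares are the seven nontrivial products of [-1], [c] and [P]. *)
Definition G2_datum s c (P := s ^+ 2 - c) :=
  [/\ ~ is_square c, ~ is_square (- c) & ~ is_square (- 1 : F)] /\
  [/\ ~ is_square P, ~ is_square (- P), ~ is_square (c * P) & ~ is_square (- (c * P))].

Lemma G1_datum_exists A f m n p q :
    ~ is_square A -> ~ is_square f -> ~ is_square (A * f) ->
    f = m ^+ 2 - A * n ^+ 2 -> A = p ^+ 2 + q ^+ 2 ->
  exists q' m', G1_datum q' m'.
Proof.
move=> nsA nsf nsAf fE AE.
have nzn : n != 0.
  by apply/eqP=> n0; apply: nsf; exists m; rewrite fE n0 expr0n mulr0 subr0.
have nzp : p != 0.
  by apply/eqP=> p0; apply: nsA; exists q; rewrite AE p0 expr0n add0r.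
exists (q / p), (m / (n * p)); rewrite /G1_datum.
have -> : 1 + (q / p) ^+ 2 = A / p ^+ 2 by rewrite AE; field.
have -> : (m / (n * p)) ^+ 2 - A / p ^+ 2 = f / (n * p) ^+ 2.
  by rewrite fE; field; rewrite nzn nzp.
split=> sq.
- apply: nsA; apply: (@is_square_mulr _ p^-1); first by rewrite invr_neq0.
  by rewrite exprVn.
- apply: nsf; apply: (@is_square_mulr _ (n * p)^-1); last by rewrite exprVn.
  by rewrite invr_neq0 ?mulf_neq0.
- apply: nsAf; apply: (@is_square_mulr _ (n * p * p)^-1).
    by rewrite invr_neq0 ?mulf_neq0.
  by move: sq; congr is_square; field; rewrite nzn nzp.
Qed.

Hypothesis two_neq0 : 2%:R != 0 :> F.

(** Nonrigidity gives [f = x^2 + a y^2] outside the classes of 1 and [a]. If [-1] is a square, [-a]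
    is a sum of two squares. If [-f] or [-(a f)] is a square, then [-1] is a value of [<1, a>], so
    [-a] is again a sum of two squares and [-1] takes the place of [f]. Otherwise [-1], [-a], [f]
    are independent, which is the second datum. *)
Lemma nonrigid_datum : ~ rigid_field F ->
  (exists q m, G1_datum q m) \/ (exists s c, G2_datum s c).
Proof.
move=> nrF; have [a na] := not_all_ex_not _ _ nrF.
have [nza na'] := imply_to_and _ _ na; have [pm nra] := imply_to_and _ _ na'.
have [f nrf] := not_all_ex_not _ _ nra.
have [fa nfa] : repr_1a a f /\ ~ (exists b, b != 0 /\ (f = b ^+ 2 \/ f = a * b ^+ 2)).
  apply: NNPP => H; apply: nrf; split=> [fa | [b [nzb fb]]].
    by apply: NNPP => nb; apply: H.
  split; first by case: fb => ->; rewrite ?mulf_neq0 ?expf_neq0.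
  by case: fb => ->; [exists b, 0 | exists 0, b]; ring.
case: fa => nzf [x [y fE]]; have nsa : ~ is_square a by move=> ?; apply: pm; left.
have nsNa : ~ is_square (- a) by move=> ?; apply: pm; right.
have nsf : ~ is_square f.
  move=> [b E]; apply: nfa; exists b; split; last by left.
  by apply: contraNneq nzf => b0; rewrite E b0 expr0n.
have nsaf : ~ is_square (a * f).
  move=> [b E]; apply: nfa; exists (b / a); split.
    have: a * f != 0 by rewrite mulf_neq0.
    by rewrite E expf_eq0 /= => ?; rewrite mulf_neq0 ?invr_neq0.
  by right; rewrite expr_div_n -E; field.
have nzy : y != 0.
  by apply/eqP=> y0; apply: nsf; exists x; rewrite fE y0; ring.
have nzx : x != 0.
  by apply/eqP=> x0; apply: nsaf; exists (a * y); rewrite fE x0; ring.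
have [[i Ei] | ns1] := classic (is_square (- 1 : F)).
  (* The two squares come from [((1 - a)/2)^2 - ((1 + a)/2)^2 = -a], the minus sign being absorbed
     by [i]. *)
  left; apply: (@G1_datum_exists (- a) f x y ((- a + 1) / 2%:R) (i * (- a - 1) / 2%:R)) => //.
  - move=> [b E]; apply: nsaf; exists (i * b).
    by rewrite exprMn -Ei -E; ring.
  - by rewrite fE; ring.
  - by rewrite -[i * _ * _]mulrA [(i * _) ^+ 2]exprMn -Ei; field; exact: two_neq0.
have neg1 : is_square (- f) \/ is_square (- (a * f)) ->
    exists m n, - 1 = m ^+ 2 - (- a) * n ^+ 2.
  case=> [[g E] | [g E]].
    have nzg : g != 0.
      by apply: contraNneq nzf => g0; rewrite -oppr_eq0 E g0 expr0n.
    exists (x / g), (y / g); rewrite !expr_div_n -E; field: fE.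
    by rewrite oppr_eq0.
  have nzg : g != 0.
    apply: contraNneq (mulf_neq0 nza nzf) => g0.
    by rewrite -oppr_eq0 E g0 expr0n.
  (* [(a y)^2 + a x^2 = a f], and [g^2 = -(a f)]. *)
  exists (a * y / g), (x / g); rewrite !expr_div_n -E; field: fE.
  by rewrite ?oppr_eq0 ?mulf_neq0 ?nzf ?nza.
have [sq | nsq] := classic (is_square (- f) \/ is_square (- (a * f))).
  have [m [n E]] := neg1 sq; left.
  have nzn : n != 0.
    by apply/eqP=> n0; apply: ns1; exists m; rewrite E n0; ring.
  apply: (@G1_datum_exists (- a) (- 1) m n (m / n) (n^-1)) => //.
  - by rewrite mulrN1 opprK.
  - have -> : - a = (m ^+ 2 + 1) / n ^+ 2; last by field.
    by apply/eqP; rewrite eq_sym -[1]opprK E; apply/eqP; field.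
right; exists (x / y), (- a); rewrite /G2_datum !opprK.
have -> : (x / y) ^+ 2 + a = f / y ^+ 2 by rewrite fE; field.
have sqE b : is_square (b / y ^+ 2) -> is_square b.
  by rewrite -exprVn; apply: is_square_mulr; rewrite invr_neq0.
split; split=> //; rewrite ?mulNr ?opprK ?mulrA -?mulNr => /sqE sq.
- exact: nsf.
- by apply: nsq; left.
- by apply: nsq; right; rewrite -mulNr.
- exact: nsaf.
Qed.
End Squares.

End BinaryForms.

(** * From Galois groups to norms *)

Section GroupsToNorms.
Local Open Scope ring_scope.

Section GaloisFixed.
Variables (F : fieldType) (L : splittingFieldType F).
Implicit Types (g h : gal_of {:L}) (a b t : L) (k : F).

Lemma galMf g h a : (g * h)%g a = h (g a). Proof. by rewrite galM ?memvf. Qed.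

Lemma gal_commute g h a : commute g h -> g (h a) = h (g a).
Proof. by move=> gh; rewrite -!galMf gh. Qed.

Lemma gal_scalar g k : g k%:A = k%:A. Proof. by rewrite linearZ /= rmorph1. Qed.

Lemma gal_fix_gen (A : {set gal_of {:L}}) a g :
  {in A, forall h, h a = a} -> g \in <<A>>%g -> g a = a.
Proof.
move=> Aa; rewrite -gal_generated => /fixed_gal; apply; first exact: subvf.
by apply/fixedFieldP; rewrite ?memvf.
Qed.

Lemma gal_fix_cycle g a : g a = a -> {in <[g]>%g, forall h, h a = a}.
Proof. by move=> ga h /gal_fix_gen; apply=> _ /set1P->. Qed.

Lemma gal_fix_joing (A B : {set gal_of {:L}}) a :
    {in A, forall h, h a = a} -> {in B, forall h, h a = a} ->
  {in (A <*> B)%g, forall h, h a = a}.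
Proof. by move=> Aa Ba h /gal_fix_gen; apply=> g /setUP[/Aa|/Ba]. Qed.

Lemma gal_fix_norm (H : {group gal_of {:L}}) h a : h \in 'N(H)%g ->
  {in H, forall g, g a = a} -> {in H, forall g, g (h a) = h a}.
Proof.
move=> nHh Ha g Hg; rewrite -galMf (_ : h * g = g ^ h^-1 * h)%g; last first.
  by rewrite conjgE invgK mulgA mulgKV.
by rewrite galMf Ha // memJ_norm ?groupV.
Qed.

(** By Artin's theorem the automorphisms fixing the fixed field of [H] are exactly those in [H]. *)
Lemma gal_moved (H : {group gal_of {:L}}) h : h \notin H ->
  exists a, {in H, forall g, g a = a} /\ h a != a.
Proof.
rewrite -{1}(genGid H) -gal_generated gal_kHom ?subvf // => nh.
have /subvPn[a fa na] : ~~ (fixedField H <= fixedSpace h)%VS.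
  by apply: contra nh => sub; apply/kAHomP=> a /(subvP sub)/fixedSpaceP.
exists a; split; last by apply: contra na => /eqP e; apply/fixedSpaceP.
exact/(fixedFieldP (memvf a)).
Qed.

Hypothesis galL : galois 1%AS {:L}.

Lemma gal_fixed_scalar a :
  {in 'Gal({:L} / 1)%g, forall g, g a = a} -> exists k, a = k%:A.
Proof.
move=> fa; have : a \in fixedField 'Gal({:L} / 1)%g by apply/fixedFieldP; rewrite ?memvf.
by rewrite (galois_fixedField galL) => /vlineP[k ->]; exists k.
Qed.

Hypothesis two_neq0 : 2%:R != 0 :> F.

Lemma two_neq0L : 2%:R != 0 :> L.
Proof. by rewrite -(rmorph_nat (in_alg L)) fmorph_eq0. Qed.

Lemma eqNr_eq0 a : (- a == a) = (a == 0).
Proof. by rewrite eq_sym -subr_eq0 opprK -mulr2n -mulr_natl mulf_eq0 (negPf two_neq0L). Qed.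

Lemma nonsquare_moved g t k : t ^+ 2 = k%:A -> t != 0 -> g t = - t -> ~ is_square k.
Proof.
move=> tk nzt gt [b E]; have : t ^+ 2 == b%:A ^+ 2.
  by rewrite tk E; apply/eqP; exact: (rmorphXn (in_alg L)).
rewrite eqf_sqr => tb; have gt' : g t = t.
  by case/orP: tb => /eqP->; rewrite ?rmorphN /= gal_scalar.
by move/eqP: gt; rewrite gt' eq_sym eqNr_eq0 (negPf nzt).
Qed.

Lemma galois_G1_nonrigid : isG1 'Gal({:L} / 1%AS)%g -> ~ rigid_field F.
Proof.
move=> /isG1_elim[x [y [defG xyP nd1]]].
have [c dc] : exists c, c = [~ x, y]%g by exists [~ x, y]%g.
have [d dd] : exists d, d = [~ c, x]%g by exists [~ c, x]%g.
rewrite -dc -dd in nd1.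
have [[cd cy cx2] [yx cx dx1 yx2]] := G1_relE xyP dc dd.
have nx2 := G1_x2_notin xyP dc dd nd1; have nc := G1_c_notin xyP dc dd nd1.
have nNx := G1_norm xyP dc dd.
case: xyP; rewrite -dc -dd => x4 y2 c2 d2 [dx dy].
have fixF a : x a = a -> y a = a -> exists k, a = k%:A.
  move=> xa ya; apply: gal_fixed_scalar => g; rewrite -defG; move: g.
  by apply: gal_fix_joing; apply: gal_fix_cycle.
have nz2 := two_neq0L.
have [al [fal nal]] := gal_moved nx2.
pose be := al - (x ^+ 2)%g al; pose ga := x be.
have nzbe : be != 0 by rewrite subr_eq0 eq_sym.
have nzga : ga != 0 by rewrite fmorph_eq0.
have xga : x ga = - be.
  rewrite -galMf -(expgS x 1) /be rmorphB /= -galMf -expgD x4 gal_id.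
  by rewrite opprB.
have ybe : y be = be.
  have Ny : (y \in <[d]> <*> <[c]> <*> <[y]>)%g by apply/mem_joingr/cycle_id.
  rewrite rmorphB /= fal // (@gal_fix_norm (<[d]> <*> <[c]> <*> <[y]>)%G) //.
  by rewrite groupX.
have yga : y ga = ga.
  rewrite (@gal_fix_norm (<[d]> <*> <[c]> <*> <[y]>)%G) //; last first.
    exact/mem_joingr/cycle_id.
  move=> g Ng; rewrite rmorphB /= fal // (@gal_fix_norm (<[d]> <*> <[c]> <*> <[y]>)%G) //.
  by rewrite groupX.
(* [x] sends [be] to [ga] and [ga] to [-be]: it negates [S] and [be^2 - ga^2] and fixes
   [be^2 + ga^2]. The identity [4 (be ga)^2 = (be^2 + ga^2)^2 - (be^2 - ga^2)^2] then makes [A] a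
   norm from [F(S)]. *)
pose S := be * ga; have nzS : S != 0 by rewrite mulf_neq0.
have xS : x S = - S by rewrite rmorphM /= xga mulrN mulrC.
have yS : y S = S by rewrite rmorphM /= ybe yga.
have [A AE] : exists k, S ^+ 2 = k%:A.
  by apply: fixF; rewrite rmorphXn /= ?xS ?yS ?sqrrN.
have [t tE] : exists k, (be ^+ 2 - ga ^+ 2) / S = k%:A.
  apply: fixF; rewrite fmorph_div rmorphB /= !rmorphXn /= ?xS ?yS ?ybe ?yga //.
  by rewrite xga sqrrN invrN mulrN -mulNr opprB.
have [n nE] : exists k, be ^+ 2 + ga ^+ 2 = k%:A.
  apply: fixF; rewrite rmorphD /= !rmorphXn /= ?ybe ?yga //.
  by rewrite xga sqrrN addrC.
have inA k1 k2 : k1%:A = k2%:A :> L -> k1 = k2 by apply: (fmorph_inj (in_alg L)).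
have AE2 : A = (n / 2%:R) ^+ 2 - A * (t / 2%:R) ^+ 2.
  apply: inA; rewrite -AE.
  rewrite -[RHS]/(in_alg L _) rmorphB [X in _ - X]rmorphM !rmorphXn !fmorph_div !rmorph_nat /=.
  rewrite -AE -tE -nE /S; field.
  by rewrite nz2 nzbe nzga.
(* The dihedral part: [rho] is negated by [c] and fixed by [y], [x ^+ 2] and [d], and the same
   identity for [rho], [rho'] exhibits [f] as a norm. *)
have [al' [fal' nal']] := gal_moved nc.
pose rho := al' - c al'; pose rho' := x rho.
have nzrho : rho != 0 by rewrite subr_eq0 eq_sym.
have nzrho' : rho' != 0 by rewrite fmorph_eq0.
have fixc g : commute g c -> g al' = al' -> g rho = rho.
  by move=> gc ga'; rewrite rmorphB /= ga' gal_commute // ga'.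
have fy : y rho = rho.
  apply: fixc; first exact: commute_sym.
  by apply: fal'; apply/mem_joingl/mem_joingr/cycle_id.
have fx2 : (x ^+ 2)%g rho = rho.
  apply: fixc; first exact: commute_sym.
  by apply: fal'; apply/mem_joingr/cycle_id.
have fd : d rho = rho.
  apply: fixc; first exact: commute_sym.
  by apply: fal'; apply/mem_joingl/mem_joingl/cycle_id.
have fc : c rho = - rho.
  by rewrite rmorphB /= -galMf -(expgS c 1) c2 gal_id opprB.
have xrho' : x rho' = rho by rewrite -galMf -(expgS x 1) fx2.
(* Automorphisms compose from left to right, so rewriting [x * y] as [y * c * x * d] lets [y] and
   [c], whose effect on [rho] is known, act first. *)
have yrho' : y rho' = - rho'.
  rewrite -galMf (_ : x * y = y * c * x * d)%g.
    by rewrite !galMf fy fc !rmorphN /= -galMf -dx galMf fd.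
  have xy : (x * y = y * x * c)%g.
    by rewrite [(y * x)%g]conjgC yx -!mulgA -(expgS c 1) c2 mulg1.
  rewrite xy -!mulgA; congr (_ * _)%g; rewrite !mulgA [(c * x)%g]conjgC cx.
  by rewrite -!mulgA -(expgS d 1) d2 mulg1.
pose f0 := rho * rho'; have nzf0 : f0 != 0 by rewrite mulf_neq0.
have xf0 : x f0 = f0 by rewrite rmorphM /= xrho' mulrC.
have yf0 : y f0 = - f0 by rewrite rmorphM /= yrho' fy mulrN.
have [f fE] : exists k, f0 ^+ 2 = k%:A.
  by apply: fixF; rewrite rmorphXn /= ?xf0 ?yf0 ?sqrrN.
have [m mE] : exists k, rho ^+ 2 + rho' ^+ 2 = k%:A.
  apply: fixF; rewrite rmorphD /= !rmorphXn /=.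
    by rewrite xrho' addrC.
  by rewrite fy yrho' sqrrN.
have [n' nE'] : exists k, (rho ^+ 2 - rho' ^+ 2) / S = k%:A.
  apply: fixF; rewrite fmorph_div rmorphB /= !rmorphXn /=.
    by rewrite xS xrho' invrN mulrN -mulNr opprB.
  by rewrite yS fy yrho' sqrrN.
have fE2 : f = (m / 2%:R) ^+ 2 - A * (n' / 2%:R) ^+ 2.
  apply: inA; rewrite -fE -[RHS]/(in_alg L _).
  rewrite rmorphB [X in _ - X]rmorphM !rmorphXn !fmorph_div !rmorph_nat /=.
  rewrite -AE -mE -nE' /f0; field.
  by rewrite nz2 nzS.
apply: (@nonrigid_G1 _ A f) fE2 AE2.
- exact: nonsquare_moved AE nzS xS.
- exact: nonsquare_moved fE nzf0 yf0.
have Af : (S * f0) ^+ 2 = (A * f)%:A.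
  by rewrite exprMn AE fE -[RHS]/(in_alg L _) rmorphM.
apply: (nonsquare_moved Af (mulf_neq0 nzS nzf0)) (_ : x _ = _).
by rewrite rmorphM /= xS xf0 mulNr.
Qed.

(* The quotient of G2 by the normal closure of z is dihedral of order 8, so it
   exhibits c0 ^+ 2 as a norm from the quadratic extension generated by D. *)
Lemma G2_dihedral (x y z : gal_of {:L}) : G2_rel x y z -> [~ y, [~ x, z]]%g != 1%g ->
  exists c0 D e : L, [/\ c0 != 0, D != 0 & c0 ^+ 2 = e ^+ 2 - D ^+ 2] /\
    [/\ x c0 = - c0, y c0 = c0 & z c0 = c0] /\
    [/\ x D = D, y D = - D & z D = D] /\ [/\ x e = e, y e = e & z e = e].
Proof.
move=> xyzP nw1; have nz2 := two_neq0L.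
have [u du] : exists u, u = [~ x, y]%g by exists [~ x, y]%g.
have [v dv] : exists v, v = [~ x, z]%g by exists [~ x, z]%g.
have [w dw] : exists w, w = [~ y, v]%g by exists [~ y, v]%g.
rewrite -dv -dw in nw1; have nu := G2_u_notin xyzP du dv dw nw1.
have := G2_relE xyzP du dv dw.
case=> [[x2 y2 z2 w2] [[u2 v2 zu] [[xu xv yu zv yz] [[xw yw zw uw vw]]]]].
move=> [uv xy xz uz vy].
have [al [fal nal]] := gal_moved nu; pose rho := al - u al; pose rho' := y rho.
have nzrho : rho != 0 by rewrite subr_eq0 eq_sym.
have nzrho' : rho' != 0 by rewrite fmorph_eq0.
have fx : x rho = rho.
  have xal : x al = al by apply: fal; apply/mem_joingl/mem_joingr/cycle_id.
  by rewrite rmorphB /= xal gal_commute // xal.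
have fz : z rho = rho.
  have zal : z al = al by apply: fal; apply/mem_joingr/cycle_id.
  have wal : w al = al by apply: fal; apply/mem_joingl/mem_joingl/mem_joingl/cycle_id.
  by rewrite rmorphB /= zal -galMf conjgC uz !galMf zal -galMf uw galMf wal.
have fu : u rho = - rho.
  by rewrite rmorphB /= -galMf -(expgS u 1) u2 gal_id opprB.
have yrho' : y rho' = rho by rewrite -galMf -(expgS y 1) y2 gal_id.
have xrho' : x rho' = - rho'.
  rewrite -galMf (_ : y * x = x * u * y)%g.
    by rewrite !galMf fx fu rmorphN.
  by rewrite [(y * x)%g]commgC -invg_comm -du involution_inv // -!mulgA yu.
have zrho' : z rho' = rho' by rewrite gal_commute ?fz //; apply: commute_sym.
(* Equality would give [rho' = rho] or [rho' = - rho], but [x] fixes [rho] and negates [rho']. *)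
have nzD : rho ^+ 2 - rho' ^+ 2 != 0.
  rewrite subr_eq0 eqf_sqr; apply/orP=> -[] /eqP E; move/eqP: xrho'.
    by rewrite -E fx eq_sym eqNr_eq0 (negPf nzrho).
  by rewrite -[rho']opprK -E rmorphN /= fx opprK eqNr_eq0 (negPf nzrho).
exists (rho * rho'), ((rho ^+ 2 - rho' ^+ 2) / 2%:R), ((rho ^+ 2 + rho' ^+ 2) / 2%:R).
have g2 (g : gal_of {:L}) : g 2%:R = 2%:R by rewrite rmorph_nat.
split; first by split; [exact: mulf_neq0 | rewrite mulf_neq0 ?invr_neq0 | field].
split; first by split; rewrite rmorphM /= ?fx ?xrho' ?yrho' ?fz ?zrho' ?mulrN // mulrC.
split; split; rewrite fmorph_div /= g2 ?(rmorphB, rmorphD) /= !rmorphXn /=.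
- by rewrite fx xrho' sqrrN.
- by rewrite -/rho' yrho' -[RHS]mulNr opprB.
- by rewrite fz zrho'.
- by rewrite fx xrho' sqrrN.
- by rewrite -/rho' yrho' addrC.
- by rewrite fz zrho'.
Qed.

Lemma galois_G2_nonrigid : isG2 'Gal({:L} / 1%AS)%g -> ~ rigid_field F.
Proof.
move=> /isG2_elim[x [y [z [defG xyzP nw1]]]].
have fixF a : x a = a -> y a = a -> z a = a -> exists k, a = k%:A.
  move=> xa ya za; apply: gal_fixed_scalar => g; rewrite -defG; move: g.
  by do 2?apply: gal_fix_joing; apply: gal_fix_cycle.
have [c0 [D [e [[nzc0 nzD cE] [[xc yc zc] [[xD yD zD] [xe ye ze]]]]]]] :=
  G2_dihedral xyzP nw1.
have nw1' : [~ z, [~ x, y]]%g != 1%g by case: xyzP => _ _ <-.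
have [c1 [D' [e' [[nzc1 nzD' cE'] [[xc1 zc1 yc1] [[xD' zD' yD'] [xe' ze' ye']]]]]]] :=
  G2_dihedral (G2_rel_sym xyzP) nw1'.
have [c dc] : exists k, c0 ^+ 2 = k%:A.
  by apply: fixF; rewrite rmorphXn /= ?xc ?yc ?zc ?sqrrN.
(* Both [c0] and [c1] are negated by [x] and fixed by [y] and [z], so they have the same square
   class over [F] and a single [c] serves both norms. *)
have [k dk] : exists k, c1 / c0 = k%:A.
  apply: fixF; rewrite fmorph_div /= ?xc ?yc ?zc ?xc1 ?yc1 ?zc1 //.
  by rewrite invrN mulrNN.
have [a da] : exists k, D ^+ 2 = k%:A.
  by apply: fixF; rewrite rmorphXn /= ?xD ?yD ?zD ?sqrrN.
have [b db] : exists k, D' ^+ 2 = k%:A.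
  by apply: fixF; rewrite rmorphXn /= ?xD' ?yD' ?zD' ?sqrrN.
have [m dm] := fixF _ xe ye ze; have [p dp] := fixF _ xe' ye' ze'.
have inA k1 k2 : k1%:A = k2%:A :> L -> k1 = k2 by apply: (fmorph_inj (in_alg L)).
have prodE (s t : L) i j : s ^+ 2 = i%:A -> t ^+ 2 = j%:A -> (s * t) ^+ 2 = (i * j)%:A.
  by move=> si tj; rewrite exprMn si tj -[RHS]/(in_alg L _) rmorphM.
have cE1 : c = m ^+ 2 - a * 1 ^+ 2.
  apply: inA; rewrite expr1n mulr1 -[RHS]/(in_alg L _) rmorphB rmorphXn /=.
  by rewrite -dc -da -dm.
have nzk : k%:A != 0 :> L by rewrite -dk mulf_neq0 ?invr_neq0.
have cE2 : c = (p / k) ^+ 2 - b * (k^-1) ^+ 2.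
  apply: inA; rewrite -[RHS]/(in_alg L _) rmorphB [X in _ - X]rmorphM !rmorphXn fmorph_div fmorphV /=.
  rewrite -dc -db -dp -dk expr_div_n !exprVn -mulrBl -cE'; field.
  by rewrite nzc0.
apply: (nonrigid_G2 _ _ _ _ _ _ cE1 cE2).
- exact: nonsquare_moved da nzD yD.
- exact: nonsquare_moved db nzD' zD'.
- exact: nonsquare_moved dc nzc0 xc.
- apply: (nonsquare_moved (prodE _ _ _ _ da db) (mulf_neq0 nzD nzD')) (_ : y _ = _).
  by rewrite rmorphM /= yD yD' mulNr.
- apply: (nonsquare_moved (prodE _ _ _ _ da dc) (mulf_neq0 nzD nzc0)) (_ : y _ = _).
  by rewrite rmorphM /= yD yc mulNr.
- apply: (nonsquare_moved (prodE _ _ _ _ db dc) (mulf_neq0 nzD' nzc0)) (_ : z _ = _).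
  by rewrite rmorphM /= zD' zc mulNr.
Qed.
End GaloisFixed.

End GroupsToNorms.

(** * Splitting fields *)

Section SplittingFields.
Local Open Scope ring_scope.

Lemma irreducible_factor (F : fieldType) (p : {poly F}) :
  (1 < size p)%N -> exists2 r, irreducible_poly r & r %| p.
Proof.
move: {2}(size p) (leqnn (size p)) => n; elim: n p => [|n IHn] p.
  by rewrite leqn0 => /eqP->.
move=> le_p_n p_gt1; have [irr | ] := classic (irreducible_poly p).
  by exists p.
move=> nirr; have [r [sr rp nrp]] :
    exists r : {poly F}, [/\ (1 < size r)%N, r %| p & (size r < size p)%N].
  apply: NNPP => nr; apply: nirr; split=> // q sq qp.
  have nzp : p != 0 by rewrite -size_poly_gt0 ltnW.
  rewrite -dvdp_size_eqp // eqn_leq dvdp_leq //= leqNgt; apply/negP=> lt_qp.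
  apply: nr; exists q; split=> //; rewrite ltn_neqAle eq_sym sq.
  by rewrite size_poly_gt0 (dvdpN0 qp).
have [|//|t irr_t tr] := IHn r; first by rewrite -ltnS (leq_trans nrp).
by exists t => //; apply: dvdp_trans tr rp.
Qed.

Definition splits_in (F : fieldType) (L : fieldExtType F) (p : {poly F}) :=
  exists zs : seq L, map_poly (in_alg L) p %= \prod_(z <- zs) ('X - z%:P).

(** The induction on the degree runs over all fields at once, because adjoining a root changes the
    base; the extension found over [K] is finally viewed over [F]. *)
Lemma splits_in_exists (F : fieldType) (p : {poly F}) :
  p != 0 -> exists L : fieldExtType F, splits_in L p.
Proof.
move: {2}(size p) (leqnn (size p)) => n; elim: n F p => [|n IHn] F p.
  by rewrite leqn0 size_poly_eq0 => ->.
move=> le_p_n nzp; have [le1 | gt1] := leqP (size p) 1.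
  exists F^o, [::]; rewrite big_nil -size_poly_eq1 size_map_poly.
  by rewrite eqn_leq le1 size_poly_gt0.
have [r irr_r /dvdpP[s ps]] := irreducible_factor gt1.
have [K _ [x rx _]] := irredp_FAdjoin irr_r.
have /factor_theorem[q Dq] : root (map_poly (in_alg K) p) x.
  by rewrite ps rmorphM rootM rx orbT.
have nzq : q != 0.
  have: map_poly (in_alg K) p != 0 by rewrite map_poly_eq0.
  by rewrite Dq mulf_eq0 => /norP[].
have [L [zs Dz]] : exists L : fieldExtType K, splits_in L q.
  apply: (IHn K q _ nzq); rewrite -ltnS; apply: leq_trans le_p_n.
  have /(congr1 (fun p : {poly K} => size p)) := Dq.
  rewrite size_map_poly size_mul ?polyXsubC_eq0 // size_XsubC addn2.
  by move=> ->.
suff [ys Dp] : exists ys : seq L, map_poly (in_alg L) (map_poly (in_alg K) p)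
    %= \prod_(z <- ys) ('X - z%:P).
  exists (baseFieldType L), ys; rewrite -map_poly_comp in Dp.
  by rewrite (eq_map_poly (fun a : F => baseField_scaleE a 1)).
exists (x%:A :: zs); rewrite big_cons Dq rmorphM /= mulrC rmorphB /= map_polyX.
by rewrite map_polyC; apply: eqp_mull.
Qed.

(* The splitting field is cut out of a field in which p splits as the subfield
   generated by the roots. *)
Lemma splitting_field_exists (F : fieldType) (p : {poly F}) : p != 0 ->
  exists L : splittingFieldType F, splittingFieldFor 1 (map_poly (in_alg L) p) {:L}.
Proof.
move=> /splits_in_exists[M [ys Dp]]; pose L := subvs_of <<1 & ys>>%AS.
pose zs : seq L := map (vsproj <<1 & ys>>%AS) ys.
have Dys : map (vsval : L -> M) zs = ys.
  rewrite -map_comp map_id_in // => y ys_y.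
  by rewrite /= vsprojK ?seqv_sub_adjoin.
pose toM : 'AHom(L, M) := linfun_ahom (vsval : L -> M).
have toME z : toM z = vsval z by rewrite lfunE.
have splitL : splittingFieldFor 1 (map_poly (in_alg L) p) {:L}.
  exists zs.
    rewrite -(eqp_map toM) -map_poly_comp rmorph_prod.
    rewrite (eq_map_poly (fun a : F => rmorph_alg toM a)).
    apply: eqp_trans Dp _.
    rewrite -[X in \prod_(z <- X) _]Dys big_map.
    set lhs := (X in X %= _); set rhs := (X in _ %= X).
    suff -> : rhs = lhs by apply: eqpxx.
    by apply: eq_bigr => z _; rewrite rmorphB /= map_polyX map_polyC /= toME.
  apply/vspaceP=> u; rewrite memvf.
  have : toM u \in (toM @: <<1 & zs>>)%VS.
    rewrite aimg_adjoin_seq aimg1 (eq_map toME) Dys toME; exact: subvsP.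
  by case/memv_imgP=> t zs_t /(fmorph_inj toM)->.
have axL : splitting_field_axiom L.
  by exists (map_poly (in_alg L) p); [apply: alg_polyOver | exact: splitL].
pose mix := FieldExt_isSplittingField.Build F L axL.
pose SL : splittingFieldType F := HB.pack L mix.
by exists SL.
Qed.

End SplittingFields.

(** * Towers of square roots *)

Section Towers.
Local Open Scope ring_scope.

Section SquareRootTowers.
Variables (F : fieldType) (L : splittingFieldType F).
Implicit Types (K : {subfield L}) (r t : L).

Lemma root_sqrt K r : r ^+ 2 \in K ->
  exists2 f : {poly L}, f \is a polyOver K & f = ('X - r%:P) * ('X - (- r)%:P).
Proof.
move=> Kr; exists ('X^2 - (r ^+ 2)%:P).
  by rewrite rpredB ?rpredX ?polyOverX ?polyOverC.
by rewrite polyCN opprK [(r ^+ 2)%:P]rmorphXn subr_sqr.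
Qed.

Lemma dim_adjoin_sqrt K r : r ^+ 2 \in K -> (\dim <<K; r>> <= 2 * \dim K)%N.
Proof.
move=> Kr; rewrite dim_Fadjoin leq_mul2r; apply/orP; right.
have [f Kf fE] := root_sqrt Kr.
rewrite -ltnS -size_minPoly; have -> : 2.+1 = size f.
  by rewrite fE size_mul ?polyXsubC_eq0 // !size_XsubC.
apply: dvdp_leq; first by rewrite fE mulf_neq0 ?polyXsubC_eq0.
by apply: minPoly_dvdp; rewrite // fE rootM root_XsubC eqxx.
Qed.

(** Steps may be trivial, so a tower bounds the degree only from above. *)
Fixpoint sqrt_tower K (s : seq L) : Prop :=
  if s is r :: s' then r ^+ 2 \in K /\ sqrt_tower <<K; r>>%AS s' else True.

Lemma dim_sqrt_tower K s : sqrt_tower K s -> (\dim <<K & s>> <= 2 ^ size s * \dim K)%N.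
Proof.
elim: s K => [|r s IHs] K /=; first by rewrite Fadjoin_nil mul1n.
case=> Kr /IHs; rewrite adjoin_cons => /leq_trans; apply.
by rewrite expnS mulnAC [(2 * _ * _)%N]mulnC leq_mul2l dim_adjoin_sqrt ?orbT.
Qed.

Hypothesis two_neq0 : 2%:R != 0 :> F.

Lemma separable_sqrt K r : r ^+ 2 \in K -> separable_element K r.
Proof.
move=> Kr; have [->|nzr] := eqVneq r 0; first by rewrite base_separable ?mem0v.
have [f Kf fE] := root_sqrt Kr; apply/separable_elementP; exists f; split=> //.
  by rewrite fE rootM root_XsubC eqxx.
have -> : f = \prod_(z <- [:: r; - r]) ('X - z%:P) by rewrite big_cons big_seq1.
by rewrite separable_prod_XsubC /= inE andbT eq_sym (eqNr_eq0 two_neq0).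
Qed.

Lemma separable_sqrt_tower K s : sqrt_tower K s -> separable K <<K & s>>.
Proof.
elim: s K => [|r s IHs] K /=; first by rewrite Fadjoin_nil separable_refl.
case=> Kr /IHs sep; rewrite adjoin_cons.
apply: (@separable_trans _ _ <<K; r>>%AS) sep.
by rewrite -adjoin_separable_eq separable_sqrt.
Qed.

(** Normality is built into [splittingFieldType]; separability is checked on generators, each with
    its own tower. *)
Lemma galois_sqrt_towers (rs : seq L) : <<1 & rs>>%VS = {:L}%VS ->
    (forall r, r \in rs -> exists2 s, sqrt_tower 1%AS s & r \in s) ->
  galois 1%AS {:L}.
Proof.
move=> genL tow; rewrite /galois sub1v normalFieldf andbT /= -genL.
apply: separable_Fadjoin_seq; apply/allP=> r /tow[s tows sr].
have /separableP := separable_sqrt_tower tows; apply.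
exact: seqv_sub_adjoin.
Qed.

Lemma gal_eq_gen (rs : seq L) (g h : gal_of {:L}) : <<1 & rs>>%VS = {:L}%VS ->
  {in rs, forall r, g r = h r} -> g = h.
Proof.
move=> genL gh; have fixk a : (g * h^-1)%g a = a.
  have : a \in fixedField [set (g * h^-1)%g].
    have /subvP : (<<1 & rs>> <= fixedField [set (g * h^-1)%g])%VS; last first.
      by apply; rewrite genL memvf.
    apply/Fadjoin_seqP; split; first exact: sub1v.
    move=> r /gh gr; apply/(fixedFieldP (memvf r)) => _ /set1P->.
    by rewrite galMf gr -galMf mulgV gal_id.
  by move/(fixedFieldP (memvf a)); apply; apply: set11.
apply/eqP; rewrite eq_mulgV1; apply/gal_eqP=> a _.
by rewrite fixk gal_id.
Qed.

End SquareRootTowers.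

End Towers.

(** * Realization of G1 *)

Section RealizationG1.
Local Open Scope ring_scope.

(** One shape covers both constructions: G1 uses [e = 0] and G2 uses [b = 0]. *)
Lemma octic_splitting (F : fieldType) (k a b e : F) :
  exists (L : splittingFieldType F) (rs : seq L),
    [/\ <<1 & rs>>%VS = {:L}%VS, rs != [::] & forall z, z \in rs ->
      ((z ^+ 2 - k%:A) ^+ 2 + a%:A) ^+ 2 + b%:A * z ^+ 4 + e%:A = 0].
Proof.
pose p : {poly F} := (('X^2 - k%:P) ^+ 2 + a%:P) ^+ 2 + (b *: 'X^4 + e%:P).
have szsq (g : {poly F}) n : size g = n.+1 -> size (g ^+ 2) = (n + n).+1.
  by move=> sg; rewrite expr2 size_mul -?size_poly_gt0 sg // addSn addnS.
have sz1 : size ('X^2 - k%:P) = 3 by rewrite size_XnsubC.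
have sz2 : size (('X^2 - k%:P) ^+ 2 + a%:P) = 5.
  by rewrite size_polyDl (szsq _ _ sz1) // (leq_ltn_trans (size_polyC_leq1 _)).
have szp : size p = 9.
  rewrite size_polyDl (szsq _ _ sz2) //=.
  apply: leq_ltn_trans (size_polyD _ _) _; rewrite gtn_max.
  rewrite (leq_ltn_trans (size_scale_leq _ _)) ?size_polyXn //=.
  by rewrite (leq_ltn_trans (size_polyC_leq1 _)).
have nzp : p != 0 by rewrite -size_poly_gt0 szp.
have [L [rs Dp genL]] := splitting_field_exists nzp.
exists L, rs; split=> // [|z].
  apply/eqP=> rs0; have := eqp_size Dp.
  by rewrite size_map_poly szp rs0 big_nil size_poly1.
rewrite -root_prod_XsubC -(eqp_root Dp) /p.
rewrite !(rmorphD, rmorphXn, rmorphN) /= map_polyZ !rmorphXn /= map_polyX !map_polyC.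
by move/rootP; rewrite !hornerE.
Qed.

(** * Signs of square roots under automorphisms *)

Section Signs.
Variables (F : fieldType) (L : splittingFieldType F).
Implicit Types (g h : gal_of {:L}) (r t : L).

Lemma eq_or_eqN_of_sqr r t : r ^+ 2 = t ^+ 2 -> r = t \/ r = - t.
Proof. by move/eqP; rewrite eqf_sqr => /orP[]/eqP; [left | right]. Qed.

(** If [g] and [h] both negate [r], then [h] fixes [t], so [g * h] fixes [r] and negates [t];
    otherwise one of them already works. *)
Lemma gal_sign_separate (H : {pred gal_of {:L}}) r t :
    {in H &, forall g h, (g * h)%g \in H} -> r != 0 -> t != 0 ->
    {in H, forall g, g r = r \/ g r = - r} ->
    (exists2 g, g \in H & g t = - t) ->
    (exists2 g, g \in H & g (r * t) = - (r * t)) ->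
  exists g, [/\ g \in H, g r = r & g t = - t].
Proof.
move=> HM nzr nzt Hr [g Hg gt] [h Hh hrt].
have [gr | gr] := Hr g Hg; first by exists g.
have [hr | hr] := Hr h Hh; move: hrt; rewrite rmorphM /= hr.
  by rewrite -mulrN => /(mulfI nzr) ht; exists h.
rewrite mulNr => /oppr_inj/(mulfI nzr) ht; exists (g * h)%g.
by rewrite HM // !galMf gr gt !rmorphN /= hr ht opprK.
Qed.

Hypothesis galL : galois 1%AS {:L}.

Lemma gal_nonsquare t k : t ^+ 2 = k%:A -> ~ is_square k ->
  exists2 g, g \in 'Gal({:L} / 1%AS)%g & g t = - t.
Proof.
move=> tk nsk; have [g Gg ngt] : exists2 g, g \in 'Gal({:L} / 1%AS)%g & g t != t.
  apply: NNPP => nex; apply: nsk.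
  have [|b tb] := @gal_fixed_scalar _ _ galL t.
    by move=> g Gg; apply/eqP; apply: contra_notT nex => ?; exists g.
  exists b; apply: (fmorph_inj (in_alg L)); rewrite rmorphXn /= -tb.
  by rewrite tk.
exists g => //; have : g t ^+ 2 = t ^+ 2 by rewrite -rmorphXn /= tk gal_scalar.
by case/eq_or_eqN_of_sqr=> // gt; rewrite gt eqxx in ngt.
Qed.

Lemma gal_scalar_sign g t k : t ^+ 2 = k%:A -> g t = t \/ g t = - t.
Proof.
move=> tk; apply: eq_or_eqN_of_sqr.
by rewrite -rmorphXn /= tk gal_scalar.
Qed.
End Signs.

Section RealizeG1.
Variables (F : fieldType) (L : splittingFieldType F).
Hypothesis two_neq0 : 2%:R != 0 :> F.
Variables (q m : F).
Hypothesis datum : G1_datum q m.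
Variables A f k : L.
Hypotheses (AD : A = 1 + q%:A ^+ 2) (fD : f = m%:A ^+ 2 - A).
Hypothesis kD : k = q%:A * m%:A - A.

Definition G1_root (r s d : L) :=
  [/\ s ^+ 2 = A, d ^+ 2 = - 2%:R * k * (A - s) & r ^+ 2 = k + s + d].

Lemma G1_scalars : [/\ A = (1 + q ^+ 2)%:A, f = (m ^+ 2 - (1 + q ^+ 2))%:A,
  k = (q * m - (1 + q ^+ 2))%:A & [/\ q%:A != 0 :> L, A != 0, f != 0 & k != 0]].
Proof.
have [nsA nsf nsAf] := datum.
have AE : A = (1 + q ^+ 2)%:A.
  by rewrite AD -[RHS]/(in_alg L _) rmorphD rmorph1 rmorphXn.
have fE : f = (m ^+ 2 - (1 + q ^+ 2))%:A.
  by rewrite fD AE -[RHS]/(in_alg L _) rmorphB rmorphXn.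
have kE : k = (q * m - (1 + q ^+ 2))%:A.
  by rewrite kD AE -[RHS]/(in_alg L _) rmorphB rmorphM.
have inj0 (a : F) : a != 0 -> a%:A != 0 :> L.
  by rewrite -(fmorph_eq0 (in_alg L)).
have nzq : q != 0.
  apply/eqP=> q0; apply: nsA; exists 1; by rewrite q0; ring.
split=> //; split; rewrite ?AE ?fE ?kE; apply: inj0 => //; try exact: nonsquare_neq0.
(* [k = 0] means [m = A / q]; then [f = A (A - q^2) / q^2 = A / q^2], and [A f] is a square. *)
apply/eqP=> k0; apply: nsAf; exists ((1 + q ^+ 2) / q).
have E : q * m = 1 + q ^+ 2 by apply/eqP; rewrite -subr_eq0 k0.
have -> : m = (1 + q ^+ 2) / q by rewrite -E; field.
by field.
Qed.

(** With [T = r^2 - k = s + d], the equation for [d^2] becomes [T^2 + A (1 + 2k) = 2 s r^2], which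
    is linear in [s]. Squaring it gives the octic; dividing by [2 r^2] recovers [s]. At [r = 0] the
    inner expression is [q^2 f], which is nonzero. *)
Lemma G1_rootP r : ((r ^+ 2 - k) ^+ 2 + A * (1 + 2%:R * k)) ^+ 2 = 4%:R * A * r ^+ 4 ->
  exists s d, G1_root r s d.
Proof.
have [_ _ _ [nzq nzA nzf nzk]] := G1_scalars.
have nz2 := two_neq0L L two_neq0.
move=> E; have nzr : r != 0.
  apply/eqP=> r0; move: E; rewrite r0 !expr0n mulr0 sub0r => /eqP.
  rewrite expf_eq0 /= => /eqP E.
  have : q%:A ^+ 2 * f = 0 by rewrite -E kD fD AD; ring.
  by move/eqP; rewrite mulf_eq0 expf_eq0 /= (negPf nzq) (negPf nzf).
pose T := r ^+ 2 - k; pose s := (T ^+ 2 + A * (1 + 2%:R * k)) / (2%:R * r ^+ 2).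
exists s, (T - s).
have sE : s * (2%:R * r ^+ 2) = T ^+ 2 + A * (1 + 2%:R * k).
  by rewrite mulfVK // mulf_neq0 ?expf_neq0.
have s2 : s ^+ 2 = A.
  rewrite expr_div_n E; field.
  by rewrite nzr nz2.
split=> //; last by rewrite /T; ring.
have -> : (T - s) ^+ 2 = T ^+ 2 - 2%:R * s * T + s ^+ 2 by ring.
have -> : T ^+ 2 = s * (2%:R * r ^+ 2) - A * (1 + 2%:R * k) by rewrite sE; ring.
by rewrite s2 /T; ring.
Qed.

Lemma G1_root_tower r s d : G1_root r s d -> sqrt_tower 1%AS [:: s; d; r].
Proof.
have [AE fE kE _] := G1_scalars; case=> s2 d2 r2.
have scal (a : F) (K : {subfield L}) : a%:A \in K by rewrite rpredZ ?mem1v.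
have nat2 (K : {subfield L}) n : n%:R \in K by rewrite rpredMn ?mem1v.
rewrite /= s2 d2 r2 AE scal kE; split=> //; split.
  by rewrite rpredM ?rpredM ?rpredN ?nat2 ?scal // rpredB ?scal ?memv_adjoin.
split=> //; rewrite !rpredD ?scal ?memv_adjoin //.
exact/subvP_adjoin/memv_adjoin.
Qed.

Variable rs : seq L.
Hypothesis genL : <<1 & rs>>%VS = {:L}%VS.
Hypothesis rs_neq0 : rs != [::].
Hypothesis rsP : forall r, r \in rs -> exists s d, G1_root r s d.

Lemma G1_galois : galois 1%AS {:L}.
Proof.
apply: (galois_sqrt_towers two_neq0 genL) => r /rsP[s [d /G1_root_tower tow]].
by exists [:: s; d; r] => //; rewrite !inE eqxx !orbT.
Qed.

(** [x] cycles the square roots [r1], [r2], [r3], [r4] of the conjugates of theta, and [y]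
    multiplies them by signs [a, b, -a, -b]. Whatever [a] and [b] are, [[~ x, y]] has signs
    [-ab, ab, -ab, ab] and [[~ [~ x, y], x]] negates all four. *)
Lemma G1_realized : isG1 'Gal({:L} / 1%AS)%g.
Proof.
have galL := G1_galois; have nz2 := two_neq0L L two_neq0.
have [AE fE kE [nzq nzA nzf nzk]] := G1_scalars; have [nsA nsf nsAf] := datum.
have eq2 := @eq_or_eqN_of_sqr _ L.
have gA (g : gal_of {:L}) : g A = A by rewrite AE gal_scalar.
have gk (g : gal_of {:L}) : g k = k by rewrite kE gal_scalar.
have [r1 [s [d [s2 d2 r12]]]] : exists r s d, G1_root r s d.
  case: rs rs_neq0 rsP => // r rs' _ /(_ r (mem_head _ _))[s [d H]].
  by exists r, s, d.
have nzs : s != 0 by apply/eqP=> s0; move/eqP: nzA; rewrite -s2 s0 expr0n.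
have nzd : d != 0.
  have: d ^+ 2 != 0; last by rewrite expf_eq0.
  rewrite d2 !mulf_neq0 ?oppr_eq0 // subr_eq0; apply/eqP=> As.
  have: A * (A - 1) = 0 by rewrite mulrBr mulr1 -{3}s2 -As expr2 subrr.
  move/eqP; rewrite mulf_eq0 (negPf nzA) AD addrC addKr expf_eq0 /=.
  by rewrite (negPf nzq).
have [x Gx xs] := gal_nonsquare galL (etrans s2 AE) nsA.
pose d' := x d; pose r2 := x r1; pose r3 := x r2; pose r4 := x r3.
have d'2 : d' ^+ 2 = - 2%:R * k * (A + s).
  by rewrite -rmorphXn /= d2 !rmorphM rmorphN rmorph_nat rmorphB /= gk gA xs opprK.
have nzd' : d' != 0 by rewrite fmorph_eq0.
(* [(A - s)(A + s) = A^2 - A = q^2 A], so [d d'] is [2 k q s] up to sign; hence [x] negates it and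
   acts on [d] with order 4. *)
have [dd' dd'2] : exists dd', d * d' = dd' * s /\ forall g : gal_of {:L}, g dd' = dd'.
  have gkq (g : gal_of {:L}) : g (2%:R * k * q%:A) = 2%:R * k * q%:A.
    by rewrite !rmorphM rmorph_nat /= gk gal_scalar.
  have /eq2[E | E] : (d * d') ^+ 2 = (2%:R * k * q%:A * s) ^+ 2.
    rewrite exprMn d2 d'2.
    have -> : - 2%:R * k * (A - s) * (- 2%:R * k * (A + s))
      = 2%:R ^+ 2 * k ^+ 2 * (A ^+ 2 - s ^+ 2) by ring.
    by rewrite [RHS]exprMn s2 AD; ring.
    by exists (2%:R * k * q%:A).
  exists (- (2%:R * k * q%:A)); rewrite mulNr E; split=> // g.
  by rewrite rmorphN /= gkq.
case: dd'2 => dd's gdd'.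
have xd' : x d' = - d.
  apply: (mulfI nzd'); rewrite -[d' in LHS]/(x d) -rmorphM /= dd's rmorphM /= xs gdd'.
  by rewrite mulrN -dd's mulrN mulrC.
have r22 : r2 ^+ 2 = k - s + d' by rewrite -rmorphXn /= r12 !rmorphD /= gk xs.
have r32 : r3 ^+ 2 = k + s - d.
  by rewrite -rmorphXn /= r22 rmorphD rmorphB /= gk xs xd' opprK.
have r42 : r4 ^+ 2 = k - s - d' by rewrite -rmorphXn /= r32 rmorphB rmorphD /= gk xs.
pose phi := r1 * r3.
have phi2 : phi ^+ 2 = q%:A ^+ 2 * f.
  rewrite exprMn r12 r32; have -> : (k + s + d) * (k + s - d) = (k + s) ^+ 2 - d ^+ 2 by ring.
  by rewrite d2 sqrrD s2 fD kD AD; ring.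
have psi2 : (r2 * r4) ^+ 2 = q%:A ^+ 2 * f.
  rewrite exprMn r22 r42; have -> : (k - s + d') * (k - s - d') = (k - s) ^+ 2 - d' ^+ 2 by ring.
  by rewrite d'2 sqrrB s2 fD kD AD; ring.
have nzphi : phi != 0.
  by apply/eqP=> p0; move/eqP: phi2; rewrite p0 expr0n eq_sym mulf_eq0 expf_eq0 (negPf nzq) (negPf nzf).
have [nzr1 nzr3] : r1 != 0 /\ r3 != 0 by apply/andP; rewrite -negb_or -mulf_eq0.
have nzr2 : r2 != 0 by rewrite fmorph_eq0.
have nzr4 : r4 != 0 by rewrite fmorph_eq0.
have [e [eE psiE ge]] : exists e : L, [/\ e * e = 1, r2 * r4 = e * phi & forall g : gal_of {:L}, g e = e].
  have /eq2[E | E] : (r2 * r4) ^+ 2 = phi ^+ 2 by rewrite phi2 psi2.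
    by exists 1; rewrite !mul1r; split=> // g; rewrite rmorph1.
  by exists (- 1); rewrite mulrNN !mulN1r mul1r; split=> // g; rewrite rmorphN rmorph1.
have xphi : x phi = e * phi by rewrite rmorphM /= psiE.
(* Whatever the sign [e], applying [x] twice to [phi = r1 r3] gives [e e phi = phi], so the cycle
   closes without a sign and [x] has order 4. *)
have xr4 : x r4 = r1.
  apply: (mulfI nzr3); have : x (r2 * r4) = e * (e * phi) by rewrite psiE rmorphM /= ge xphi.
  by rewrite rmorphM /= mulrA eE mul1r [r3 * r1]mulrC.
have [g0 [Gg0 g0s g0phi]] : exists g, [/\ g \in 'Gal({:L} / 1%AS)%g, g s = s & g phi = - phi].
  apply: gal_sign_separate => //.
  - by move=> g h; apply: groupM.
  - by move=> g _; apply: (gal_scalar_sign g (etrans s2 AE)).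
  - apply: (@gal_nonsquare _ _ galL _ ((m ^+ 2 - (1 + q ^+ 2)) * q ^+ 2)).
      rewrite phi2 fE -[RHS]/(in_alg L _) [in RHS]rmorphM rmorphXn mulrC /=.
      by [].
    apply: contra_not nsf; apply: is_square_mulr.
    by apply: contraNneq nzq => ->; rewrite scale0r.
  - apply: (@gal_nonsquare _ _ galL _ ((1 + q ^+ 2) * (m ^+ 2 - (1 + q ^+ 2)) * q ^+ 2)).
      rewrite exprMn phi2 s2 fE AE -[RHS]/(in_alg L _) 2![in RHS]rmorphM rmorphXn /=.
      by rewrite mulrA mulrAC.
    apply: contra_not nsAf; apply: is_square_mulr.
    by apply: contraNneq nzq => ->; rewrite scale0r.
(* If [g0] negates [d], it is corrected by [x ^+ 2], which negates [d] and fixes [s] and [phi]. *)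
have [y [Gy ys yphi yd]] : exists y,
    [/\ y \in 'Gal({:L} / 1%AS)%g, y s = s, y phi = - phi & y d = d].
  have : g0 d ^+ 2 = d ^+ 2.
    by rewrite -rmorphXn /= d2 !rmorphM rmorphN rmorph_nat rmorphB /= gk gA g0s.
  case/eq2=> g0d; first by exists g0.
  exists (g0 * (x * x))%g; rewrite !groupM // !galMf g0s g0phi g0d !rmorphN /=.
  rewrite xs xphi rmorphM /= ge xphi rmorphN /= xs -/d' xd' mulrA eE mul1r.
  by rewrite !opprK.
have yd' : y d' = d'.
  apply: (mulfI nzd); rewrite -{1}yd -rmorphM /= dd's rmorphM /= ys gdd'.
  by [].
have signy r r' : r * r' != 0 -> y r ^+ 2 = r ^+ 2 -> y (r * r') = - (r * r') ->
    exists a : L, [/\ a * a = 1, forall g : gal_of {:L}, g a = a, y r = a * r & y r' = - (a * r')].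
  rewrite mulf_eq0 negb_or => /andP[nzr nzr'] /eq2[] yr; rewrite rmorphM /= yr.
    rewrite -mulrN => /(mulfI nzr) yr'; exists 1; rewrite !mul1r; split=> // g.
    by rewrite rmorph1.
  rewrite mulNr => /oppr_inj/(mulfI nzr) yr'; exists (- 1).
  by rewrite mulrNN !mulN1r mul1r opprK; split=> // g; rewrite rmorphN rmorph1.
have [a [aa ga ya1 ya3]] : exists a : L, [/\ a * a = 1,
    forall g : gal_of {:L}, g a = a, y r1 = a * r1 & y r3 = - (a * r3)].
  apply: signy => //; by rewrite -rmorphXn /= r12 !rmorphD /= gk ys yd.
have [b [bb gb yb2 yb4]] : exists a : L, [/\ a * a = 1,
    forall g : gal_of {:L}, g a = a, y r2 = a * r2 & y r4 = - (a * r4)].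
  apply: signy; first by rewrite mulf_neq0.
    by rewrite -rmorphXn /= r22 rmorphD rmorphB /= gk ys yd'.
  by rewrite psiE rmorphM /= ge yphi mulrN.
have rs_cover r : r \in rs ->
    [\/ r = r1 \/ r = - r1, r = r2 \/ r = - r2, r = r3 \/ r = - r3 | r = r4 \/ r = - r4].
  case/rsP=> s' [d'' [s'2 d''2 r'2]].
  have /eq2[sE | sE] : s' ^+ 2 = s ^+ 2 by rewrite s'2 s2.
    have /eq2[dE | dE] : d'' ^+ 2 = d ^+ 2 by rewrite d''2 d2 sE.
      by constructor 1; apply: eq2; rewrite r'2 r12 sE dE.
    by constructor 3; apply: eq2; rewrite r'2 r32 sE dE.
  have /eq2[dE | dE] : d'' ^+ 2 = d' ^+ 2 by rewrite d''2 d'2 sE opprK.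
    by constructor 2; apply: eq2; rewrite r'2 r22 sE dE.
  by constructor 4; apply: eq2; rewrite r'2 r42 sE dE.
have eqG (g h : gal_of {:L}) :
    g r1 = h r1 -> g r2 = h r2 -> g r3 = h r3 -> g r4 = h r4 -> g = h.
  move=> e1 e2 e3 e4; apply: (gal_eq_gen genL) => r.
  by case/rs_cover=> -[] ->; rewrite ?rmorphN /= ?e1 ?e2 ?e3 ?e4.
(* Five square roots suffice: [d'] lies in [F(s, d)], and [r4 = e r1 r3 / r2]. *)
have cardG : (#|'Gal({:L} / 1%AS)%g| <= 32)%N.
  rewrite -(galois_dim galL) dimv1 divn1.
  pose t := [:: s; d; r1; r2; r3].
  have [K genK] : exists K : {subfield L}, K = <<1 & t>>%AS by eexists.
  have Kt z : z \in t -> z \in K by rewrite genK; apply: seqv_sub_adjoin.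
  have sLK : ({:L} <= K)%VS.
    rewrite -genL; apply/Fadjoin_seqP.
    split=> [|r]; first exact: sub1v.
    have K1 : r1 \in K by rewrite Kt ?inE ?eqxx ?orbT.
    have K2 : r2 \in K by rewrite Kt ?inE ?eqxx ?orbT.
    have K3 : r3 \in K by rewrite Kt ?inE ?eqxx ?orbT.
    have Ke : e \in K.
      have /eq2[-> | ->] : e ^+ 2 = 1 ^+ 2 by rewrite expr1n expr2.
        exact: mem1v.
      by rewrite rpredN mem1v.
    have K4 : r4 \in K.
      by rewrite -[r4](mulKf nzr2) psiE rpredM ?rpredV // rpredM // rpredM.
    by case/rs_cover=> -[] ->; rewrite ?rpredN.
  have scal (a0 : F) (K0 : {subfield L}) : a0%:A \in K0 by rewrite rpredZ ?mem1v.
  apply: leq_trans (dimvS sLK) _; suff tow : sqrt_tower 1%AS t.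
    by have := dim_sqrt_tower tow; rewrite dimv1 muln1 genK.
  have [t1 [t2 [t3 _]]] : sqrt_tower 1%AS [:: s; d; r1] by apply: G1_root_tower.
  split=> //; split=> //; split=> //.
  set K3 := <<_; r1>>%AS.
  have K3s : s \in K3 by apply/subvP_adjoin/subvP_adjoin/memv_adjoin.
  have K3d : d \in K3 by apply/subvP_adjoin/memv_adjoin.
  have K3d' : d' \in K3.
    have [j jE] : exists j, dd' = j%:A by apply: (gal_fixed_scalar galL) => g _.
    by rewrite -[d'](mulKf nzd) dd's jE rpredM ?rpredV // rpredM ?scal.
  have K3k : k \in K3 by rewrite kE scal.
  split; first by rewrite r22 rpredD ?rpredB.
  by split=> //; apply: subvP_adjoin; rewrite r32 rpredB ?rpredD.
have xV1 : x^-1%g r1 = r4 by rewrite -xr4 -galMf mulgV gal_id.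
have xV2 : x^-1%g r2 = r1 by rewrite -galMf mulgV gal_id.
have xV3 : x^-1%g r3 = r2 by rewrite -galMf mulgV gal_id.
have xV4 : x^-1%g r4 = r3 by rewrite -galMf mulgV gal_id.
have y2 : (y ^+ 2 = 1)%g.
  by apply: eqG; rewrite expgS expg1 galMf gal_id ?ya1 ?yb2 ?ya3 ?yb4
    ?rmorphN rmorphM /= ?ga ?gb ?ya1 ?yb2 ?ya3 ?yb4 ?mulrN ?opprK mulrA ?aa ?bb mul1r.
have yV := involution_inv y2.
have x4 : (x ^+ 4 = 1)%g.
  by apply: eqG; rewrite !expgS expg0 mulg1 !galMf gal_id -?/r2 -?/r3 -?/r4 ?xr4 -?/r2 -?/r3 -?/r4 ?xr4.
have [c dc] : exists c, c = [~ x, y]%g by exists [~ x, y]%g.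
have [w dw] : exists w, w = [~ c, x]%g by exists [~ c, x]%g.
have cE t : c t = y (x (y (x^-1%g t))).
  by rewrite dc commgEl conjgE yV !galMf.
have c1 : c r1 = - (a * b * r1).
  by rewrite cE xV1 yb4 !rmorphN rmorphM /= xr4 gb rmorphM /= gb ya1 mulrCA mulrA.
have c2 : c r2 = a * b * r2.
  by rewrite cE xV2 ya1 rmorphM /= ga rmorphM /= ga yb2 mulrA.
have c3 : c r3 = - (a * b * r3).
  by rewrite cE xV3 yb2 rmorphM /= gb rmorphM /= gb ya3 mulrN mulrCA mulrA.
have c4 : c r4 = a * b * r4.
  by rewrite cE xV4 ya3 !rmorphN rmorphM /= ga rmorphM /= ga yb4 mulrN opprK mulrA.
have ab2 : a * b * (a * b) = 1 by rewrite mulrACA aa bb mulr1.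
have gab (g : gal_of {:L}) : g (a * b) = a * b by rewrite rmorphM /= ga gb.
have c22 : (c ^+ 2 = 1)%g.
  by apply: eqG; rewrite expgS expg1 galMf gal_id ?c1 ?c2 ?c3 ?c4
    ?rmorphN rmorphM /= gab ?c1 ?c2 ?c3 ?c4 ?mulrN ?opprK mulrA ab2 mul1r.
have cV := involution_inv c22.
have wE t : w t = x (c (x^-1%g (c t))).
  by rewrite dw commgEl conjgE cV !galMf.
have gabM (g : gal_of {:L}) t : g (a * b * t) = a * b * g t by rewrite rmorphM /= gab.
have abK t : a * b * (a * b * t) = t by rewrite mulrA ab2 mul1r.
have w1 : w r1 = - r1 by rewrite wE c1 !rmorphN /= !gabM xV1 c4 !gabM abK xr4.
have w2 : w r2 = - r2 by rewrite wE c2 !gabM xV2 c1 !rmorphN /= !gabM mulrN abK.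
have w3 : w r3 = - r3 by rewrite wE c3 !rmorphN /= !gabM xV3 c2 !gabM abK.
have w4 : w r4 = - r4 by rewrite wE c4 !gabM xV4 c3 !rmorphN /= !gabM mulrN abK.
have xyP : G1_rel x y.
  rewrite /G1_rel -dc -dw; split=> //.
    by apply: eqG; rewrite expgS expg1 galMf gal_id ?w1 ?w2 ?w3 ?w4 rmorphN /= ?w1 ?w2 ?w3 ?w4 opprK.
  split; apply: eqG; rewrite !galMf ?w1 ?w2 ?w3 ?w4 ?rmorphN /= -?/r2 -?/r3 -?/r4
    ?xr4 ?ya1 ?yb2 ?ya3 ?yb4 ?rmorphN ?rmorphM /= ?ga ?gb ?w1 ?w2 ?w3 ?w4 ?mulrN //.
have nw1 : w != 1%g.
  apply/eqP=> w0; move/eqP: w1; rewrite w0 gal_id eq_sym (eqNr_eq0 two_neq0).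
  by rewrite (negPf nzr1).
apply: (@isG1_intro _ _ x y) => //; last by rewrite -dc -dw.
apply/eqP; rewrite eqEcard join_subG !cycle_subG Gx Gy (leq_trans cardG) //.
apply: (card_G1_ge xyP dc dw nw1 (G := (<[x]> <*> <[y]>)%G)).
  exact/mem_joingl/cycle_id.
exact/mem_joingr/cycle_id.
Qed.
End RealizeG1.

Lemma G1_datum_realized (F : fieldType) (q m : F) : 2%:R != 0 :> F -> G1_datum q m ->
  exists L : splittingFieldType F, galois 1%AS {:L} /\ isG1 'Gal({:L} / 1%AS)%g.
Proof.
move=> nz2 datum; have [A A0] : exists A, A = 1 + q ^+ 2 by eexists.
have [k k0] : exists k, k = q * m - A by eexists.
have [L [rs [genL nzrs rsP]]] := octic_splitting k (A * (1 + 2%:R * k)) (- (4%:R * A)) 0.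
exists L; have AD : A%:A = 1 + q%:A ^+ 2 :> L.
  by rewrite -[LHS]/(in_alg L _) A0 rmorphD rmorph1 rmorphXn.
have kD : k%:A = q%:A * m%:A - A%:A :> L.
  by rewrite -[LHS]/(in_alg L _) k0 rmorphB rmorphM.
have rootP r : r \in rs -> exists s d, G1_root A%:A k%:A r s d.
  move/rsP=> E; apply: (G1_rootP nz2 datum AD erefl kD).
  apply/eqP; rewrite -subr_eq0 -E scale0r addr0; apply/eqP.
  rewrite -[(A * _)%:A]/(in_alg L _) -[(- _)%:A]/(in_alg L _).
  rewrite rmorphN !rmorphM rmorphD rmorphM rmorph1 !rmorph_nat /=.
  by rewrite mulNr.
split; first exact: (G1_galois nz2 datum AD erefl kD genL rootP).
exact: (G1_realized nz2 datum AD erefl kD genL nzrs rootP).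
Qed.

End RealizationG1.

(** * Realization of G2 *)

Section RealizationG2.
Local Open Scope ring_scope.

Section RealizeG2.
Variables (F : fieldType) (L : splittingFieldType F).
Hypothesis two_neq0 : 2%:R != 0 :> F.
Variables s c : F.
Hypothesis datum : G2_datum s c.

Definition G2_root (r p q : L) :=
  [/\ p ^+ 2 = (s ^+ 2 - c)%:A, q ^+ 2 = (- c)%:A & r ^+ 2 = s%:A + p + q].

Lemma G2_nonzero : s%:A != 0 :> L /\ c%:A != 0 :> L.
Proof.
have [[nsc _ _] [_ _ _ nsNcP]] := datum.
have inj0 (a : F) : a != 0 -> a%:A != 0 :> L by rewrite -(fmorph_eq0 (in_alg L)).
split; apply: inj0; last exact: nonsquare_neq0.
by apply/eqP=> s0; apply: nsNcP; exists c; rewrite s0; ring.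
Qed.

Lemma G2_scalars : (s ^+ 2 - c)%:A = s%:A ^+ 2 - c%:A :> L /\ (- c)%:A = - c%:A :> L.
Proof. by rewrite -![_%:A]/(in_alg L _) rmorphB rmorphXn rmorphN. Qed.

(** For [T = r^2 - s = p + q], the relation [p^2 - q^2 = s^2] gives [T^2 + s^2 = 2 p T], which
    determines [p]. The case [T = 0] would force [s = 0]. *)
Lemma G2_rootP r :
    ((r ^+ 2 - s%:A) ^+ 2 - (s%:A ^+ 2 - c%:A - c%:A)) ^+ 2
      + 4%:R * (s%:A ^+ 2 - c%:A) * c%:A = 0 ->
  exists p q, G2_root r p q.
Proof.
have [nzs nzc] := G2_nonzero; have nz2 := two_neq0L L two_neq0.
rewrite /G2_root; have [-> ->] := G2_scalars.
move: (s%:A) (c%:A) nzs nzc => S C nzS nzC; set T := r ^+ 2 - S => E.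
have E2 : (T ^+ 2 + S ^+ 2) ^+ 2 = 4%:R * (S ^+ 2 - C) * T ^+ 2.
  by apply/eqP; rewrite -subr_eq0 -E; apply/eqP; ring.
have nzT : T != 0.
  apply/eqP=> T0; move: E2; rewrite T0 expr0n add0r mulr0 => /eqP.
  by rewrite !expf_eq0 /= (negPf nzS).
exists ((T ^+ 2 + S ^+ 2) / (2%:R * T)), (T - (T ^+ 2 + S ^+ 2) / (2%:R * T)).
have p2 : ((T ^+ 2 + S ^+ 2) / (2%:R * T)) ^+ 2 = S ^+ 2 - C.
  by rewrite expr_div_n E2; field; rewrite ?nzT ?nz2.
split=> //; last by rewrite /T; ring.
by rewrite sqrrB p2; field; rewrite ?nzT ?nz2.
Qed.

Lemma G2_root_tower r p q : G2_root r p q -> sqrt_tower 1%AS [:: p; q; r].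
Proof.
have scal (a : F) (K : {subfield L}) : a%:A \in K by rewrite rpredZ ?mem1v.
case=> p2 q2 r2; rewrite /= p2 q2 r2 !scal; do 3!split=> //.
rewrite !rpredD ?scal ?memv_adjoin //.
exact/subvP_adjoin/memv_adjoin.
Qed.

Variable rs : seq L.
Hypothesis genL : <<1 & rs>>%VS = {:L}%VS.
Hypothesis rs_neq0 : rs != [::].
Hypothesis rsP : forall r, r \in rs -> exists p q, G2_root r p q.

Lemma G2_galois : galois 1%AS {:L}.
Proof.
apply: (galois_sqrt_towers two_neq0 genL) => r /rsP[p [q /G2_root_tower tow]].
by exists [:: p; q; r] => //; rewrite !inE eqxx !orbT.
Qed.

Lemma gal_conj_sign (g y : gal_of {:L}) (a a' e t : L) :
    (forall h : gal_of {:L}, h e = e) -> (forall h : gal_of {:L}, h t = t) -> e * e = 1 ->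
  y a = e * a' -> g a = t * a -> (g ^ y)%g a' = t * a'.
Proof.
move=> he ht ee ya ga; have -> : a' = y (e * a) by rewrite rmorphM /= ya he mulrA ee mul1r.
rewrite conjgE !galMf -[y^-1%g _]galMf mulgV gal_id rmorphM /= he ga !rmorphM /= he ht ya.
by rewrite mulrCA.
Qed.

Lemma G2_realized : isG2 'Gal({:L} / 1%AS)%g.
Proof.
have galL := G2_galois; have nz2 := two_neq0L L two_neq0.
have [[nsc nsQ ns1] [nsP nsNP nscP nsNcP]] := datum.
have [nzS nzC] := G2_nonzero; have [PE QE] := G2_scalars.
have eq2 := @eq_or_eqN_of_sqr _ L.
have [r1 [p [q [p2 q2 r12]]]] : exists r p q, G2_root r p q.
  case: rs rs_neq0 rsP => // r rs' _ /(_ r (mem_head _ _))[p [q H]].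
  by exists r, p, q.
have inj0 (a : F) : a != 0 -> a%:A != 0 :> L by rewrite -(fmorph_eq0 (in_alg L)).
have nzp : p != 0.
  apply: contraNneq (inj0 _ (nonsquare_neq0 nsP)) => p0.
  by rewrite -p2 p0 expr0n.
have nzq : q != 0.
  apply: contraNneq (inj0 _ (nonsquare_neq0 nsQ)) => q0.
  by rewrite -q2 q0 expr0n.
have scalM (a b : F) (t u : L) : t ^+ 2 = a%:A -> u ^+ 2 = b%:A -> (t * u) ^+ 2 = (a * b)%:A.
  by move=> ta ub; rewrite exprMn ta ub -[RHS]/(in_alg L _) rmorphM.
pose G := 'Gal({:L} / 1%AS)%G.
have GM : {in G &, forall g h, (g * h)%g \in G} by move=> g h; apply: groupM.
have nsPQ : ~ is_square ((s ^+ 2 - c) * - c) by rewrite mulrN mulrC.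
have [y0 [Gy0 y0q y0p]] : exists g, [/\ g \in G, g q = q & g p = - p].
  apply: gal_sign_separate => //.
  - by move=> g _; apply: (gal_scalar_sign g q2).
  - exact: (gal_nonsquare galL p2).
  - rewrite mulrC; exact: (gal_nonsquare galL (scalM _ _ _ _ p2 q2)).
have [z0 [Gz0 z0p z0q]] : exists g, [/\ g \in G, g p = p & g q = - q].
  apply: gal_sign_separate => //.
  - by move=> g _; apply: (gal_scalar_sign g p2).
  - exact: (gal_nonsquare galL q2).
  - exact: (gal_nonsquare galL (scalM _ _ _ _ p2 q2)).
pose r2 := y0 r1; pose r3 := z0 r1; pose r4 := z0 r2.
have gs := gal_scalar.
have r22 : r2 ^+ 2 = s%:A - p + q by rewrite -rmorphXn /= r12 !rmorphD /= gs y0p y0q.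
have r32 : r3 ^+ 2 = s%:A + p - q by rewrite -rmorphXn /= r12 !rmorphD /= gs z0p z0q.
have r42 : r4 ^+ 2 = s%:A - p - q.
  by rewrite -rmorphXn /= r22 rmorphD rmorphB /= gs z0p z0q.
(* [r1^2 r2^2 = 2 s q] and [r3^2 r4^2 = -2 s q], so [rho] is a square root of [c] up to squares in
   [F]. *)
pose rho := r1 * r2 * (r3 * r4).
have rho2 : rho ^+ 2 = (c * (2%:R * s) ^+ 2)%:A.
  have -> : rho ^+ 2 = r1 ^+ 2 * r2 ^+ 2 * (r3 ^+ 2 * r4 ^+ 2) by rewrite !exprMn.
  rewrite r12 r22 r32 r42.
  have -> : (s%:A + p + q) * (s%:A - p + q) = (s%:A + q) ^+ 2 - p ^+ 2 by ring.
  have -> : (s%:A + p - q) * (s%:A - p - q) = (s%:A - q) ^+ 2 - p ^+ 2 by ring.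
  have -> : (c * (2%:R * s) ^+ 2)%:A = c%:A * (2%:R * s%:A) ^+ 2 :> L.
    by rewrite -[LHS]/(in_alg L _) !(rmorphXn, rmorphM, rmorph_nat).
  rewrite p2 PE !sqrrD sqrrN q2 QE.
  transitivity (- (2%:R * s%:A * q) ^+ 2); first by ring.
  by rewrite exprMn q2 QE; ring.
have nz2s : 2%:R * s != 0.
  by rewrite mulf_neq0 //; apply: contraNneq nzS => ->; rewrite scale0r.
have nzrho : rho != 0.
  apply: contraNneq (inj0 _ (mulf_neq0 (nonsquare_neq0 nsc) (expf_neq0 2 nz2s))) => rho0.
  by rewrite -rho2 rho0 expr0n.
have nsq_mul (a b : F) : ~ is_square a -> b != 0 -> ~ is_square (a * b ^+ 2).
  by move=> nsa nzb /(is_square_mulr nzb).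
have nzc : c != 0 := nonsquare_neq0 nsc.
have [g1 [Gg1 g1p g1rho]] : exists g, [/\ g \in G, g p = p & g rho = - rho].
  apply: gal_sign_separate => //.
  - by move=> g _; apply: (gal_scalar_sign g p2).
  - by apply: (gal_nonsquare galL rho2); apply: nsq_mul.
  - apply: (gal_nonsquare galL (scalM _ _ _ _ p2 rho2)); rewrite mulrA.
    by apply: nsq_mul; rewrite // mulrC.
have [g2 [Gg2 g2p g2rho]] : exists g, [/\ g \in G, g p = p & g (q * rho) = - (q * rho)].
  apply: gal_sign_separate => //; first by rewrite mulf_neq0.
  - by move=> g _; apply: (gal_scalar_sign g p2).
  - apply: (gal_nonsquare galL (scalM _ _ _ _ q2 rho2)).
    rewrite (_ : _ * _ = - 1 * (c * (2%:R * s)) ^+ 2); last by ring.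
    by apply: nsq_mul; rewrite // mulf_neq0.
  - apply: (gal_nonsquare galL (scalM _ _ _ _ p2 (scalM _ _ _ _ q2 rho2))).
    rewrite (_ : _ * _ = - (s ^+ 2 - c) * (c * (2%:R * s)) ^+ 2); last by ring.
    by apply: nsq_mul; rewrite // mulf_neq0.
have [x0 [/andP[Gx0 /eqP x0p] x0q x0rho]] :
    exists g, [/\ g \in [pred g | (g \in G) && (g p == p)], g q = q & g rho = - rho].
  apply: gal_sign_separate => //.
  - move=> g h /andP[Gg /eqP gp] /andP[Gh /eqP hp].
    by rewrite inE groupM // galMf gp hp eqxx.
  - by move=> g _; apply: (gal_scalar_sign g q2).
  - by exists g1; rewrite // inE Gg1 g1p eqxx.
  - by exists g2; rewrite // inE Gg2 g2p eqxx.
have eq2b (t u : L) : t ^+ 2 = u ^+ 2 -> exists b : bool, t = (-1) ^+ b * u.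
  by case/eq2=> ->; [exists false; rewrite mul1r | exists true; rewrite mulN1r].
have gsgn (b : bool) (g : gal_of {:L}) : g ((-1) ^+ b) = (-1) ^+ b by rewrite rmorph_sign.
have sgn2 (b : bool) : (-1) ^+ b * (-1) ^+ b = 1 :> L by rewrite -expr2 sqrr_sign.
have gsM (g : gal_of {:L}) (b : bool) t : g ((-1) ^+ b * t) = (-1) ^+ b * g t.
  by rewrite rmorphM /= gsgn.
have [ey2 y0r2] : exists b : bool, y0 r2 = (-1) ^+ b * r1.
  by apply: eq2b; rewrite -rmorphXn /= r22 rmorphD rmorphB /= gs y0p y0q opprK r12.
have [ey3 y0r3] : exists b : bool, y0 r3 = (-1) ^+ b * r4.
  by apply: eq2b; rewrite -rmorphXn /= r32 rmorphB rmorphD /= gs y0p y0q r42.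
have [ey4 y0r4] : exists b : bool, y0 r4 = (-1) ^+ b * r3.
  by apply: eq2b; rewrite -rmorphXn /= r42 !rmorphB /= gs y0p y0q opprK r32.
have [ez3 z0r3] : exists b : bool, z0 r3 = (-1) ^+ b * r1.
  by apply: eq2b; rewrite -rmorphXn /= r32 rmorphB rmorphD /= gs z0p z0q opprK r12.
have [ez4 z0r4] : exists b : bool, z0 r4 = (-1) ^+ b * r2.
  by apply: eq2b; rewrite -rmorphXn /= r42 !rmorphB /= gs z0p z0q opprK r22.
(* [sg] describes the sign vectors realized in the Galois group: closed under addition and under the
   Klein four-group permuting places, hence an ideal of the group algebra of V4 over F_2. *)
pose sg b1 b2 b3 b4 := exists2 g, g \in G &
  [/\ g r1 = (-1) ^+ (b1 : bool) * r1, g r2 = (-1) ^+ (b2 : bool) * r2,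
      g r3 = (-1) ^+ (b3 : bool) * r3 & g r4 = (-1) ^+ (b4 : bool) * r4].
have sg0 : sg false false false false.
  by exists 1%g; [apply: group1 | split; rewrite gal_id mul1r].
have sgM b1 b2 b3 b4 c1 c2 c3 c4 : sg b1 b2 b3 b4 -> sg c1 c2 c3 c4 ->
    sg (b1 (+) c1) (b2 (+) c2) (b3 (+) c3) (b4 (+) c4).
  move=> [g Gg [e1 e2 e3 e4]] [h Gh [f1 f2 f3 f4]]; exists (g * h)%g; first exact: groupM.
  by split; rewrite galMf ?e1 ?e2 ?e3 ?e4 gsM ?f1 ?f2 ?f3 ?f4 mulrA signr_addb.
have sgY b1 b2 b3 b4 : sg b1 b2 b3 b4 -> sg b2 b1 b4 b3.
  move=> [g Gg [e1 e2 e3 e4]]; exists (g ^ y0)%g; first exact: groupJ.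
  split; [apply: gal_conj_sign y0r2 e2 | | apply: gal_conj_sign y0r4 e4
    | apply: gal_conj_sign y0r3 e3] => //.
  apply: (@gal_conj_sign _ _ _ _ 1) e1; rewrite ?mul1r // => h.
  by rewrite rmorph1.
have sgZ b1 b2 b3 b4 : sg b1 b2 b3 b4 -> sg b3 b4 b1 b2.
  move=> [g Gg [e1 e2 e3 e4]]; exists (g ^ z0)%g; first exact: groupJ.
  split; [apply: gal_conj_sign z0r3 e3 | apply: gal_conj_sign z0r4 e4 | |] => //.
    by apply: (@gal_conj_sign _ _ _ _ 1) e1; rewrite ?mul1r // => h; rewrite rmorph1.
  by apply: (@gal_conj_sign _ _ _ _ 1) e2; rewrite ?mul1r // => h; rewrite rmorph1.
have sgC (t b1 b2 b3 b4 : bool) : sg b1 b2 b3 b4 -> sg (t && b1) (t && b2) (t && b3) (t && b4).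
  by case: t.
have sg1 : sg true false false false.
  have fix2 (g : gal_of {:L}) t : g (t ^+ 2) = t ^+ 2 -> exists b : bool, g t = (-1) ^+ b * t.
    by move=> gt; apply: eq2b; rewrite -rmorphXn.
  have [b1 e1] : exists b : bool, x0 r1 = (-1) ^+ b * r1.
    by apply: fix2; rewrite r12 !rmorphD /= gs x0p x0q.
  have [b2 e2] : exists b : bool, x0 r2 = (-1) ^+ b * r2.
    by apply: fix2; rewrite r22 rmorphD rmorphB /= gs x0p x0q.
  have [b3 e3] : exists b : bool, x0 r3 = (-1) ^+ b * r3.
    by apply: fix2; rewrite r32 rmorphB rmorphD /= gs x0p x0q.
  have [b4 e4] : exists b : bool, x0 r4 = (-1) ^+ b * r4.
    by apply: fix2; rewrite r42 !rmorphB /= gs x0p x0q.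
  have sgb : sg b1 b2 b3 b4 by exists x0.
  have odd_b : b1 (+) b2 (+) (b3 (+) b4).
    apply: contraT => /negbTE even_b.
    have : x0 rho = (-1) ^+ (b1 (+) b2 (+) (b3 (+) b4)) * rho.
      by rewrite !rmorphM /= e1 e2 e3 e4 !signr_addb /rho; ring.
    rewrite even_b mul1r x0rho => /eqP; rewrite (eqNr_eq0 two_neq0).
    by rewrite (negPf nzrho).
  (* As b has odd weight, b * b = 1 in the group algebra of V4 over F_2. *)
  have := sgM _ _ _ _ _ _ _ _
    (sgM _ _ _ _ _ _ _ _ (sgC b1 _ _ _ _ sgb) (sgC b2 _ _ _ _ (sgY _ _ _ _ sgb)))
    (sgM _ _ _ _ _ _ _ _ (sgC b3 _ _ _ _ (sgZ _ _ _ _ sgb))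
      (sgC b4 _ _ _ _ (sgZ _ _ _ _ (sgY _ _ _ _ sgb)))).
  by case: (b1) (b2) (b3) (b4) odd_b => -[] [] [].
have sgA b1 b2 b3 b4 : sg b1 b2 b3 b4.
  have := sgM _ _ _ _ _ _ _ _
    (sgM _ _ _ _ _ _ _ _ (sgC b1 _ _ _ _ sg1) (sgC b2 _ _ _ _ (sgY _ _ _ _ sg1)))
    (sgM _ _ _ _ _ _ _ _ (sgC b3 _ _ _ _ (sgZ _ _ _ _ sg1))
      (sgC b4 _ _ _ _ (sgZ _ _ _ _ (sgY _ _ _ _ sg1)))).
  by case: (b1) (b2) (b3) (b4) => -[] [] [].
have [x Gx [x1 x2 x3 x4]] := sgA true false false false.
(* With all sixteen sign vectors available, the unknown signs of [y0], and likewise of [z0], are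
   cancelled, leaving pure permutations of the roots. *)
have [y [Gy [y1 y2 y3 y4]]] : exists y, y \in G /\
    [/\ y r1 = r2, y r2 = r1, y r3 = r4 & y r4 = r3].
  have [h Gh [h1 h2 h3 h4]] := sgA ey2 false ey4 ey3.
  exists (y0 * h)%g; split; first exact: groupM.
  split; rewrite galMf ?y0r2 ?y0r3 ?y0r4 ?gsM ?h1 ?h2 ?h3 ?h4 ?mul1r // mulrA sgn2 mul1r //.
have [z [Gz [z1 z2 z3 z4]]] : exists z, z \in G /\
    [/\ z r1 = r3, z r2 = r4, z r3 = r1 & z r4 = r2].
  have [h Gh [h1 h2 h3 h4]] := sgA ez3 ez4 false false.
  exists (z0 * h)%g; split; first exact: groupM.
  split; rewrite galMf ?z0r3 ?z0r4 ?gsM ?h1 ?h2 ?h3 ?h4 ?mul1r // mulrA sgn2 mul1r //.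
rewrite mulN1r in x1; rewrite mul1r in x2; rewrite mul1r in x3; rewrite mul1r in x4.
have rs_cover r : r \in rs ->
    [\/ r = r1 \/ r = - r1, r = r2 \/ r = - r2, r = r3 \/ r = - r3 | r = r4 \/ r = - r4].
  case/rsP=> p' [q' [p'2 q'2 r'2]].
  have /eq2[pE | pE] : p' ^+ 2 = p ^+ 2 by rewrite p'2 p2.
    have /eq2[qE | qE] : q' ^+ 2 = q ^+ 2 by rewrite q'2 q2.
      by constructor 1; apply: eq2; rewrite r'2 r12 pE qE.
    by constructor 3; apply: eq2; rewrite r'2 r32 pE qE.
  have /eq2[qE | qE] : q' ^+ 2 = q ^+ 2 by rewrite q'2 q2.
    by constructor 2; apply: eq2; rewrite r'2 r22 pE qE.
  by constructor 4; apply: eq2; rewrite r'2 r42 pE qE.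
have eqG (g h : gal_of {:L}) :
    g r1 = h r1 -> g r2 = h r2 -> g r3 = h r3 -> g r4 = h r4 -> g = h.
  move=> e1 e2 e3 e4; apply: (gal_eq_gen genL) => r.
  by case/rs_cover=> -[] ->; rewrite ?rmorphN /= ?e1 ?e2 ?e3 ?e4.
have cardG : (#|G| <= 64)%N.
  rewrite -(galois_dim galL) dimv1 divn1.
  pose t := [:: p; q; r1; r2; r3; r4].
  have [K genK] : exists K : {subfield L}, K = <<1 & t>>%AS by eexists.
  have Kt u : u \in t -> u \in K by rewrite genK; apply: seqv_sub_adjoin.
  have sLK : ({:L} <= K)%VS.
    rewrite -genL; apply/Fadjoin_seqP; split=> [|r]; first exact: sub1v.
    by case/rs_cover=> -[] ->; rewrite ?rpredN Kt ?inE ?eqxx ?orbT.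
  have scal (a : F) (K0 : {subfield L}) : a%:A \in K0 by rewrite rpredZ ?mem1v.
  apply: leq_trans (dimvS sLK) _; suff tow : sqrt_tower 1%AS t.
    by have := dim_sqrt_tower tow; rewrite dimv1 muln1 genK.
  have [t1 [t2 [t3 _]]] : sqrt_tower 1%AS [:: p; q; r1] by apply: G2_root_tower.
  split=> //; split=> //; split=> //.
  set K3 := <<_; r1>>%AS.
  have K3p : p \in K3 by apply/subvP_adjoin/subvP_adjoin/memv_adjoin.
  have K3q : q \in K3 by apply/subvP_adjoin/memv_adjoin.
  split; first by rewrite r22 rpredD ?rpredB ?scal.
  split; first by apply: subvP_adjoin; rewrite r32 rpredB ?rpredD ?scal.
  by split=> //; do 2!apply: subvP_adjoin; rewrite r42 !rpredB ?scal.
have xx : (x ^+ 2 = 1)%g.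
  by apply: eqG; rewrite expgS expg1 galMf gal_id ?x1 ?x2 ?x3 ?x4 ?rmorphN /= ?x1 ?opprK.
have yy : (y ^+ 2 = 1)%g.
  by apply: eqG; rewrite expgS expg1 galMf gal_id ?y1 ?y2 ?y3 ?y4.
have zz : (z ^+ 2 = 1)%g.
  by apply: eqG; rewrite expgS expg1 galMf gal_id ?z1 ?z2 ?z3 ?z4.
have [u du] : exists u, u = [~ x, y]%g by exists [~ x, y]%g.
have [v dv] : exists v, v = [~ x, z]%g by exists [~ x, z]%g.
have [w dw] : exists w, w = [~ y, v]%g by exists [~ y, v]%g.
have uE t : u t = y (x (y (x t))) by rewrite du commgEl conjgE !involution_inv // !galMf.
have vE t : v t = z (x (z (x t))) by rewrite dv commgEl conjgE !involution_inv // !galMf.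
have u1 : u r1 = - r1 by rewrite uE x1 !rmorphN /= y1 x2 y2.
have u2 : u r2 = - r2 by rewrite uE x2 y2 x1 rmorphN /= y1.
have u3 : u r3 = r3 by rewrite uE x3 y3 x4 y4.
have u4 : u r4 = r4 by rewrite uE x4 y4 x3 y3.
have v1 : v r1 = - r1 by rewrite vE x1 !rmorphN /= z1 x3 z3.
have v2 : v r2 = r2 by rewrite vE x2 z2 x4 z4.
have v3 : v r3 = - r3 by rewrite vE x3 z3 x1 rmorphN /= z1.
have v4 : v r4 = r4 by rewrite vE x4 z4 x2 z2.
have uu : (u ^+ 2 = 1)%g.
  by apply: eqG; rewrite expgS expg1 galMf gal_id ?u1 ?u2 ?u3 ?u4 ?rmorphN /= ?u1 ?u2 ?opprK.
have vv : (v ^+ 2 = 1)%g.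
  by apply: eqG; rewrite expgS expg1 galMf gal_id ?v1 ?v2 ?v3 ?v4 ?rmorphN /= ?v1 ?v3 ?opprK.
have wE t : w t = v (y (v (y t))) by rewrite dw commgEl conjgE !involution_inv // !galMf.
have w1 : w r1 = - r1 by rewrite wE y1 v2 y2 v1.
have w2 : w r2 = - r2 by rewrite wE y2 v1 !rmorphN /= y1 v2.
have w3 : w r3 = - r3 by rewrite wE y3 v4 y4 v3.
have w4 : w r4 = - r4 by rewrite wE y4 v3 !rmorphN /= y3 v4.
have ww : (w ^+ 2 = 1)%g.
  by apply: eqG; rewrite expgS expg1 galMf gal_id ?w1 ?w2 ?w3 ?w4 rmorphN /= ?w1 ?w2 ?w3 ?w4 opprK.
have wu : w = [~ z, u]%g.
  apply: eqG; rewrite commgEl conjgE !involution_inv // !galMf.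
  - by rewrite w1 z1 u3 z3 u1.
  - by rewrite w2 z2 u4 z4 u2.
  - by rewrite w3 z3 u1 !rmorphN /= z1 u3.
  - by rewrite w4 z4 u2 !rmorphN /= z2 u4.
have xyzP : G2_rel x y z.
  rewrite /G2_rel -du -dv -dw -wu; do 2!split=> //; try split=> //.
  - by apply/eqP/commgP; apply: eqG; rewrite !galMf ?y1 ?y2 ?y3 ?y4 ?z1 ?z2 ?z3 ?z4 ?y1 ?y2 ?y3 ?y4.
  - by apply: eqG; rewrite !galMf ?w1 ?w2 ?w3 ?w4 ?rmorphN /= ?x1 ?x2 ?x3 ?x4 ?rmorphN /= ?w1 ?w2 ?w3 ?w4.
  - by apply: eqG; rewrite !galMf ?w1 ?w2 ?w3 ?w4 ?rmorphN /= ?y1 ?y2 ?y3 ?y4 ?w1 ?w2 ?w3 ?w4.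
  - by apply: eqG; rewrite !galMf ?w1 ?w2 ?w3 ?w4 ?rmorphN /= ?z1 ?z2 ?z3 ?z4 ?w1 ?w2 ?w3 ?w4.
have nzr1 : r1 != 0 by apply: contraNneq nzrho => E; rewrite /rho E !mul0r.
have nw1 : w != 1%g.
  apply/eqP=> w0; move/eqP: w1; rewrite w0 gal_id eq_sym (eqNr_eq0 two_neq0).
  by rewrite (negPf nzr1).
apply: (@isG2_intro _ _ x y z) => //; last by rewrite -dv -dw.
apply/eqP; rewrite eqEcard !join_subG !cycle_subG Gx Gy Gz (leq_trans cardG) //.
apply: (card_G2_ge xyzP du dv dw nw1 (G := (<[x]> <*> <[y]> <*> <[z]>)%G)).
- exact/mem_joingl/mem_joingl/cycle_id.
- exact/mem_joingl/mem_joingr/cycle_id.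
exact/mem_joingr/cycle_id.
Qed.
End RealizeG2.

Lemma G2_datum_realized (F : fieldType) (s c : F) : 2%:R != 0 :> F -> G2_datum s c ->
  exists L : splittingFieldType F, galois 1%AS {:L} /\ isG2 'Gal({:L} / 1%AS)%g.
Proof.
move=> nz2 datum.
have [L [rs [genL nzrs rsP]]] :=
  octic_splitting s (- (s ^+ 2 - c - c)) 0 (4%:R * (s ^+ 2 - c) * c).
have rootP r : r \in rs -> exists p q, G2_root s c r p q.
  move/rsP=> E; apply: (G2_rootP nz2 datum); rewrite -[RHS]E scale0r mul0r addr0.
  rewrite -[(- _)%:A]/(in_alg L _) -[(_ * c)%:A]/(in_alg L _).
  by rewrite !(rmorphB, rmorphN, rmorphXn, rmorphM, rmorph_nat).
exists L; split; first exact: (G2_galois nz2 genL rootP).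
exact: (G2_realized nz2 datum genL nzrs rootP).
Qed.

End RealizationG2.

Theorem theorem5p1 (F : fieldType) (hchar : 2 \notin [pchar F]%R) :
  ~ rigid_field F <->
  exists L : splittingFieldType F,
    galois 1%AS {:L} /\
    (isG1 'Gal({:L} / 1%AS)%g \/ isG2 'Gal({:L} / 1%AS)%g).
Proof.
have two_neq0 : (2%:R != 0 :> F)%R by move: hchar; rewrite inE.
split=> [nrF | [L [galL [isG | isG]]]].
- have [[q [m /(G1_datum_realized two_neq0)]] | [s [c /(G2_datum_realized two_neq0)]]] :=
    nonrigid_datum two_neq0 nrF.
    by case=> L [galL isG]; exists L; split=> //; left.
  by case=> L [galL isG]; exists L; split=> //; right.
- exact: galois_G1_nonrigid isG.
- exact: galois_G2_nonrigid isG.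
Qed.
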